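(* For every $\gamma\in(1,3]$ and $m\in\{1,2\}$ there exist $P_*\in\{P_6,P_8\}$ and $z_{std}\in\mathcal Z(\gamma;P_* )$ such that $C(V_1;\gamma,z_{std},P_* )=C_1$, i.e., the local analytic solution through $P_*$ extends smoothly to the left to connect $P_*$ with $P_1=(V_1,C_1)$.
   Context: Fix $m\in\{1,2\}$, $\gamma\in(1,3]$. For $z>0$ put $\lambda=1+m\gamma z$, $a_1=1+\frac{m(\gamma-1)}{2}$, $a_2=\frac{m(\gamma-1)+mz\gamma(\gamma-3)}{2}$, $a_3=\frac{mz\gamma(\gamma-1)}{2}$, $G(V,C;\gamma,z)=C^2[(m+1)V+2mz]-V(1+V)(\lambda+V)$, $F(V,C;\gamma,z)=C\{C^2[1+\frac{mz}{1+V}]-a_1(1+V)^2+a_2(1+V)-a_3\}$; ODE $\frac{dC}{dV}=\frac FG$. $V_1=-\frac2{\gamma+1}$, $C_1=\frac{\sqrt{2\gamma(\gamma-1)}}{\gamma+1}$. $z_M=(\sqrt\gamma+\sqrt2)^{-2}$, $z_m=\frac{\gamma-1}{(2\gamma-1)(\gamma+1)}$; for $z\in(0,z_M]$, $w(z)=\sqrt{1-2(\gamma+2)z+(\gamma-2)^2z^2}$, $V_6=\frac{-1+(\gamma-2)z-w}{2}$, $C_6=1+V_6$, $V_8=\frac{-1+(\gamma-2)z+w}{2}$, $C_8=1+V_8$, $P_6=(V_6,C_6)$, $P_8=(V_8,C_8)$. $\mathcal Z(\gamma;P_6)=[z_m,z_M]$, $\mathcal Z(\gamma;P_8)=(0,z_M]$.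 For $P_*=(V_*,C_* )\in\{P_6,P_8\}$ and $z\in\mathcal Z(\gamma;P_* )$, $C(\cdot;\gamma,z,P_* ):[V_1,V_*]\to(0,\infty)$ denotes the unique real-analytic solution of the ODE near $V_*$ with $C(V_* )=C_*$ and $C'(V_* )=c_1$, where $c_1$ is the unique negative root of $-G_Cc^2+(F_C-G_V)c+F_V=0$ (partials at $P_*$), continued as a solution of the ODE to $[V_1,V_*]$. *)

(* Defs.v *)
From Stdlib Require Import Reals Lra.
From Coquelicot Require Import Coquelicot.
Open Scope R_scope.

Definition lam (mR g z : R) : R := 1 + mR * g * z.
Definition a1 (mR g : R) : R := 1 + mR * (g - 1) / 2.
Definition a2 (mR g z : R) : R := (mR * (g - 1) + mR * z * g * (g - 3)) / 2.
Definition a3 (mR g z : R) : R := mR * z * g * (g - 1) / 2.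

Definition Gf (mR g z V C : R) : R :=
  C ^ 2 * ((mR + 1) * V + 2 * mR * z) - V * (1 + V) * (lam mR g z + V).

Definition Ff (mR g z V C : R) : R :=
  C * (C ^ 2 * (1 + mR * z / (1 + V)) - a1 mR g * (1 + V) ^ 2
       + a2 mR g z * (1 + V) - a3 mR g z).

Definition V1pt (g : R) : R := - (2 / (g + 1)).
Definition C1pt (g : R) : R := sqrt (2 * g * (g - 1)) / (g + 1).

Definition zM (g : R) : R := / (sqrt g + sqrt 2) ^ 2.
Definition zm (g : R) : R := (g - 1) / ((2 * g - 1) * (g + 1)).

Definition wfun (g z : R) : R := sqrt (1 - 2 * (g + 2) * z + (g - 2) ^ 2 * z ^ 2).
Definition V6 (g z : R) : R := (-1 + (g - 2) * z - wfun g z) / 2.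
Definition C6 (g z : R) : R := 1 + V6 g z.
Definition V8 (g z : R) : R := (-1 + (g - 2) * z + wfun g z) / 2.
Definition C8 (g z : R) : R := 1 + V8 g z.

Inductive Pstar := P6 | P8.

Definition Vs (p : Pstar) (g z : R) : R :=
  match p with P6 => V6 g z | P8 => V8 g z end.
Definition Cs (p : Pstar) (g z : R) : R :=
  match p with P6 => C6 g z | P8 => C8 g z end.

Definition Zset (p : Pstar) (g z : R) : Prop :=
  match p with
  | P6 => zm g <= z <= zM g
  | P8 => 0 < z <= zM g
  end.

Definition slope_root (mR g z : R) (p : Pstar) (c : R) : Prop :=
  let V0 := Vs p g z in
  let C0 := Cs p g z in
  let GV := Derive (fun v => Gf mR g z v C0) V0 in
  let GC := Derive (fun c' => Gf mR g z V0 c') C0 in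
  let FV := Derive (fun v => Ff mR g z v C0) V0 in
  let FC := Derive (fun c' => Ff mR g z V0 c') C0 in
  c < 0 /\ - GC * c ^ 2 + (FC - GV) * c + FV = 0.

Definition is_Pstar_solution (mR g z : R) (p : Pstar) (C : R -> R) : Prop :=
  let V0 := Vs p g z in
  let C0 := Cs p g z in
  V1pt g < V0 /\
  (exists (f : R -> R) (a : nat -> R) (r : R),
      0 < r /\
      (forall x, Rabs (x - V0) < r -> is_pseries a (x - V0) (f x)) /\
      (forall x, Rabs (x - V0) < r ->
          ex_derive f x /\ Gf mR g z x (f x) * Derive f x = Ff mR g z x (f x)) /\
      f V0 = C0 /\
      slope_root mR g z p (Derive f V0) /\
      (forall x, V1pt g <= x <= V0 -> Rabs (x - V0) < r -> C x = f x)) /\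
  (forall V, V1pt g < V < V0 ->
      Gf mR g z V (C V) <> 0 /\
      is_derive C V (Ff mR g z V (C V) / Gf mR g z V (C V))) /\
  filterlim C (at_right (V1pt g)) (locally (C (V1pt g))) /\
  (forall V, V1pt g <= V <= V0 -> 0 < C V).

(* Main.v *)
Require Import Defs.
From Stdlib Require Import Reals Lra Psatz PeanoNat Wf_nat IndefiniteDescription.
From Coquelicot Require Import Coquelicot.
Open Scope R_scope.

(* Parametrise by the sonic point itself: with X = 1 + V_* and x = 1 + V, the relation
   defining V_6 and V_8 determines z from X, and both branches form the single interval
   x_1 < X < 1, x_1 = 1 + V_1. In these variables
     G = - [(X - x) q + (C^2 - X^2) d]  and  x F = C [(X - x) r + (C^2 - X^2) (x + m z)],
   with q, d, r bounded below by positive constants on x_1 <= x <= X. So in the region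
   x < X, C >= X one has G < 0 < F and |F / G| <= K C: every solution leaving P_* with
   negative slope increases to the left, stays in this region and reaches V_1 without
   blow-up. If X = C_1, monotonicity gives C(V_1) >= C_1; if X is close to x_1, the growth
   bound gives C(V_1) < C_1. Since C(V_1) depends continuously on X, some X yields C_1.
   Near P_* write C = X + t (c + w), t = x - X. Then w solves a Briot-Bouquet equation whose
   n-th divisor is n L1 - (L2 - L1), with L1 > L2 the eigenvalues and L1 > 0, hence never
   vanishes; this gives an analytic solution with radius uniform in X. *)

(** The parameter z is awkward because the two branches meet at z = z_M, where [wfun] vanishes like
    a square root; a continuity argument in z would have to cross this fold. In X nothing is
    singular there. The ODE degenerates at P_*, so neither existence nor dependence on X can be read
    off from an initial value problem posed at that point. The convergent series supplies data at a
    distance e to the left, the same for all X; they are continuous in X because the coefficients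
    are, and because their weighted l1 norms are bounded uniformly. Picard iteration and Gronwall
    then carry these data to V_1. The variable l = ln (C / X) turns the bound K C on the slope into
    a constant, and p = exp (- 2 l) maps C >= X into (0, 1]. After clamping, the right-hand side is
    bounded and globally Lipschitz, so the flow exists for all times without a continuation
    argument. The order of the constants matters: the growth bound does not depend on e, so the left
    end of the X-interval can be fixed first and e taken small relative to it. *)

(** * Weighted l1 norms of truncated coefficient sequences *)

Definition wnorm (r : R) (a : nat -> R) (N : nat) : R :=
  sum_f_R0 (fun n => Rabs (a n) * r ^ n) N.

Lemma wnorm_pos r a N : 0 <= r -> 0 <= wnorm r a N.
Proof.
intros Hr; apply cond_pos_sum; intros n.
apply Rmult_le_pos; [apply Rabs_pos | now apply pow_le].
Qed.

Lemma wnorm_mono r a N M : 0 <= r -> (N <= M)%nat -> wnorm r a N <= wnorm r a M.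
Proof.
intros Hr HNM; induction HNM as [|M HNM IH]; [lra|].
unfold wnorm in *; simpl.
assert (0 <= Rabs (a (S M)) * (r * r ^ M)).
{ apply Rmult_le_pos; [apply Rabs_pos | apply (pow_le r (S M) Hr)]. }
lra.
Qed.

Lemma wnorm_plus r a b N : 0 <= r ->
  wnorm r (PS_plus a b) N <= wnorm r a N + wnorm r b N.
Proof.
intros Hr; unfold wnorm; rewrite <- sum_plus.
apply sum_Rle; intros n _.
rewrite <- Rmult_plus_distr_r; apply Rmult_le_compat_r; [now apply pow_le|].
apply Rabs_triang.
Qed.

(** Passing from N to N + 1 adds one antidiagonal of products; it lengthens every inner sum by one
    term and opens a new one at k = N + 1. *)
Lemma cauchy_square (u v : nat -> R) N :
  sum_f_R0 (fun n => sum_f_R0 (fun k => u k * v (n - k)%nat) n) N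
  = sum_f_R0 (fun k => u k * sum_f_R0 v (N - k)) N.
Proof.
induction N as [|N IH]; [simpl; ring|].
rewrite tech5, IH.
rewrite (tech5 (fun k => u k * v (S N - k)%nat)).
rewrite (tech5 (fun k => u k * sum_f_R0 v (S N - k))).
replace (S N - S N)%nat with 0%nat by lia.
rewrite <- Rplus_assoc, <- sum_plus; f_equal.
apply sum_eq; intros k Hk.
replace (S N - k)%nat with (S (N - k)) by lia.
rewrite tech5; ring.
Qed.

(** Coefficients of a product up to order N involve only coefficients up to order N, so
    submultiplicativity holds already for truncations. Truncated norms raise no convergence question
    and can be used before the coefficients of the solution are known to be summable. *)
Lemma wnorm_mult r a b N : 0 <= r ->
  wnorm r (PS_mult a b) N <= wnorm r a N * wnorm r b N.
Proof.
intros Hr.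
apply Rle_trans with
  (sum_f_R0 (fun n => sum_f_R0
     (fun k => (Rabs (a k) * r ^ k) * (Rabs (b (n - k)%nat) * r ^ (n - k))) n) N).
- apply sum_Rle; intros n _.
  apply Rle_trans with (sum_f_R0 (fun k => Rabs (a k * b (n - k)%nat)) n * r ^ n).
  + apply Rmult_le_compat_r; [now apply pow_le | apply Rsum_abs].
  + rewrite Rmult_comm, scal_sum; apply Req_le, sum_eq; intros k Hk.
    rewrite Rabs_mult; replace n with (k + (n - k))%nat at 2 by lia.
    rewrite pow_add; ring.
- rewrite (cauchy_square (fun k => Rabs (a k) * r ^ k) (fun k => Rabs (b k) * r ^ k)).
  fold (wnorm r a N).
  unfold wnorm at 1; rewrite Rmult_comm, scal_sum.
  apply sum_Rle; intros k Hk; apply Rmult_le_compat_l.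
  + apply Rmult_le_pos; [apply Rabs_pos | now apply pow_le].
  + apply (wnorm_mono r b); [exact Hr | lia].
Qed.

Lemma wnorm_abs r a N : wnorm r (fun n => Rabs (a n)) N = wnorm r a N.
Proof. apply sum_eq; intros; now rewrite Rabs_Rabsolu. Qed.

(** Without a constant term every monomial carries at least one factor r. This is the gain from a
    small radius: it makes the forcing term and the nonconstant parts of the linear coefficients
    small. *)
Lemma wnorm_shrink r a N : 0 <= r <= 1 -> a 0%nat = 0 ->
  wnorm r a N <= r * wnorm 1 a N.
Proof.
intros Hr Ha; unfold wnorm; rewrite scal_sum.
apply sum_Rle; intros [|n] _.
- rewrite Ha, Rabs_R0; simpl; lra.
- rewrite pow1, Rmult_1_r; apply Rmult_le_compat_l; [apply Rabs_pos|].
  assert (r ^ n <= 1 ^ n) by (apply pow_incr; lra).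
  rewrite pow1 in H; simpl; nra.
Qed.

Lemma wnorm_le_1 r a N : 0 <= r <= 1 -> wnorm r a N <= wnorm 1 a N.
Proof.
intros Hr; apply sum_Rle; intros n _.
apply Rmult_le_compat_l; [apply Rabs_pos|apply pow_incr; lra].
Qed.

Lemma term_le_wnorm r a n : 0 <= r -> Rabs (a n) * r ^ n <= wnorm r a n.
Proof.
intros Hr; destruct n as [|n]; [unfold wnorm; simpl; lra|].
unfold wnorm; rewrite tech5.
assert (0 <= wnorm r a n) by now apply wnorm_pos.
unfold wnorm in H; lra.
Qed.

Lemma CV_radius_wnorm r a A : 0 < r -> (forall N, wnorm r a N <= A) ->
  Rbar_le r (CV_radius a).
Proof.
intros Hr HA.
apply (proj1 (CV_radius_bounded a)); exists A; intros n.
rewrite Rabs_mult, (Rabs_pos_eq (r ^ n)) by (apply pow_le; lra).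
apply Rle_trans with (2 := HA n); apply term_le_wnorm; lra.
Qed.

Lemma CV_radius_wnorm_lt r a A t : (forall N, wnorm r a N <= A) ->
  Rabs t < r -> Rbar_lt (Rabs t) (CV_radius a).
Proof.
intros HA Ht.
apply Rbar_lt_le_trans with r; [exact Ht|].
apply (CV_radius_wnorm r a A); [|exact HA].
generalize (Rabs_pos t); lra.
Qed.

Lemma continuous_Rplus (f g : R -> R) x :
  continuous f x -> continuous g x -> continuous (fun y => f y + g y) x.
Proof. apply (continuous_plus f g x). Qed.

Lemma continuous_Rminus (f g : R -> R) x :
  continuous f x -> continuous g x -> continuous (fun y => f y - g y) x.
Proof. apply (continuous_minus f g x). Qed.

Lemma continuous_Rmult (f g : R -> R) x :
  continuous f x -> continuous g x -> continuous (fun y => f y * g y) x.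
Proof. apply (continuous_mult f g x). Qed.

(** * Analytic families *)

Definition coef_family (a b : R) (s : R -> nat -> R) : Prop :=
  (forall n X, a <= X <= b -> continuous (fun Y => s Y n) X) /\
  (exists B, 0 <= B /\ forall X, a <= X <= b -> forall N, wnorm 1 (s X) N <= B).

(** The l1 bound at radius 1, uniform in X, is stable under sums and products, so that the
    coefficients of the equation are seen to be analytic families from their syntax alone. *)
Definition analytic_family (a b : R) (F : R -> R -> R) : Prop :=
  exists s, coef_family a b s /\
    forall X t, a <= X <= b -> Rabs t < 1 -> is_pseries (s X) t (F X t).

Lemma continuous_PS_mult (u v : R -> nat -> R) n X :
  (forall k, (k <= n)%nat -> continuous (fun Y => u Y k) X) ->
  (forall k, (k <= n)%nat -> continuous (fun Y => v Y k) X) ->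
  continuous (fun Y => PS_mult (u Y) (v Y) n) X.
Proof.
intros Hu Hv; unfold PS_mult.
assert (H : forall N, (N <= n)%nat -> continuous
   (fun Y => sum_f_R0 (fun k => u Y k * v Y (n - k)%nat) N) X).
{ induction N as [|N IH]; intros HN; simpl.
  - apply (continuous_mult (fun Y => u Y 0%nat)); [apply Hu | apply Hv]; lia.
  - apply (continuous_plus (fun Y => sum_f_R0 (fun k => u Y k * v Y (n - k)%nat) N)).
    + apply IH; lia.
    + apply (continuous_mult (fun Y => u Y (S N))); [apply Hu | apply Hv]; lia. }
now apply H.
Qed.

Lemma continuous_bounded_on (f : R -> R) a b :
  (forall X, a <= X <= b -> continuous f X) ->
  exists B, 0 <= B /\ forall X, a <= X <= b -> Rabs (f X) <= B.
Proof.
intros Hf; destruct (Rle_dec a b) as [Hab|Hab].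
- destruct (continuity_ab_maj (fun X => Rabs (f X)) a b Hab) as [M [HM _]].
  + intros c Hc; apply continuity_pt_filterlim.
    apply (continuous_comp f Rabs); [now apply Hf | apply continuous_Rabs].
  + exists (Rabs (f M)); split; [apply Rabs_pos | exact HM].
- exists 0; split; [lra|]; intros; lra.
Qed.

Lemma coef_family_bounded a b s X t B : a <= X <= b ->
  (forall N, wnorm 1 (s X) N <= B) -> Rabs t < 1 ->
  Rbar_lt (Rabs t) (CV_radius (s X)).
Proof. intros; now apply (CV_radius_wnorm_lt 1 _ B). Qed.

Lemma is_pseries_head (c : R) (a : nat -> R) (t l : R) :
  is_pseries a t l ->
  is_pseries (fun n => match n with 0%nat => c | S k => a k end) t (c + t * l).
Proof.
intros H.
assert (H1 := is_pseries_incr_1 a t l H).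
assert (H2 : is_pseries (fun n => match n with 0%nat => c | S _ => 0 end) t c).
{ apply is_pseries_R; unfold is_series.
  apply (filterlim_ext (fun _ => c)); [|apply filterlim_const].
  intros N; induction N as [|N IH].
  - rewrite sum_O; simpl; ring.
  - rewrite sum_Sn, <- IH; unfold plus; simpl; ring. }
assert (H3 := is_pseries_plus _ _ _ _ _ H2 H1).
eapply is_pseries_ext; [|exact H3].
intros [|n]; unfold PS_plus, PS_incr_1, plus, zero; simpl; ring.
Qed.

Lemma is_pseries_zero (t : R) : is_pseries (fun _ => 0) t 0.
Proof.
apply is_pseries_R; unfold is_series.
apply (filterlim_ext (fun _ => 0)); [|apply filterlim_const].
intros N; induction N as [|N IH].
- rewrite sum_O; simpl; ring.
- rewrite sum_Sn, <- IH; unfold plus; simpl; ring.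
Qed.

Lemma analytic_const a b (f : R -> R) :
  (forall X, a <= X <= b -> continuous f X) -> analytic_family a b (fun X _ => f X).
Proof.
intros Hf; exists (fun X n => match n with 0%nat => f X | S _ => 0 end); split; [split|].
- intros [|n] X HX; [now apply Hf | apply continuous_const].
- destruct (continuous_bounded_on f a b Hf) as [B [HB HfB]].
  exists B; split; [exact HB|]; intros X HX N.
  apply Rle_trans with (2 := HfB X HX).
  induction N as [|N IH]; [unfold wnorm; simpl; lra|].
  unfold wnorm in *; rewrite tech5, Rabs_R0; lra.
- intros X t _ _.
  assert (H := is_pseries_head (f X) _ t 0 (is_pseries_zero t)).
  rewrite Rmult_0_r, Rplus_0_r in H; exact H.
Qed.

Lemma analytic_var a b : analytic_family a b (fun _ t => t).
Proof.
exists (fun _ n => match n with 1%nat => 1 | _ => 0 end); split; [split|].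
- intros; apply continuous_const.
- exists 1; split; [lra|]; intros X _ N; unfold wnorm.
  destruct N as [|N]; [simpl; rewrite Rabs_R0; lra|].
  induction N as [|N IH]; [simpl; rewrite Rabs_R0, Rabs_R1; lra|].
  rewrite tech5, Rabs_R0; lra.
- intros X t _ _.
  assert (H := is_pseries_head 0 _ t _ (is_pseries_head 1 _ t 0 (is_pseries_zero t))).
  rewrite Rmult_0_r, Rplus_0_r, Rmult_1_r, Rplus_0_l in H.
  apply is_pseries_ext with (2 := H); now intros [|[|n]].
Qed.

Lemma analytic_plus a b F H : analytic_family a b F -> analytic_family a b H ->
  analytic_family a b (fun X t => F X t + H X t).
Proof.
intros [u [[Cu [Bu [Pu Hu]]] Fu]] [v [[Cv [Bv [Pv Hv]]] Fv]].
exists (fun X => PS_plus (u X) (v X)); split; [split|].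
- intros n X HX; apply (continuous_plus (fun Y => u Y n)); [now apply Cu | now apply Cv].
- exists (Bu + Bv); split; [lra|]; intros X HX N.
  apply Rle_trans with (1 := wnorm_plus 1 (u X) (v X) N Rle_0_1).
  specialize (Hu X HX N); specialize (Hv X HX N); lra.
- intros X t HX Ht; apply (is_pseries_plus (u X)); [now apply Fu | now apply Fv].
Qed.

Lemma analytic_mult a b F H : analytic_family a b F -> analytic_family a b H ->
  analytic_family a b (fun X t => F X t * H X t).
Proof.
intros [u [[Cu [Bu [Pu Hu]]] Fu]] [v [[Cv [Bv [Pv Hv]]] Fv]].
exists (fun X => PS_mult (u X) (v X)); split; [split|].
- intros n X HX; apply continuous_PS_mult; intros; [now apply Cu | now apply Cv].
- exists (Bu * Bv); split; [nra|]; intros X HX N.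
  apply Rle_trans with (1 := wnorm_mult 1 (u X) (v X) N Rle_0_1).
  apply Rmult_le_compat; try (apply wnorm_pos; lra); auto.
- intros X t HX Ht; apply is_pseries_mult; [now apply Fu | now apply Fv | |].
  + apply (coef_family_bounded a b u X t Bu); auto.
  + apply (coef_family_bounded a b v X t Bv); auto.
Qed.

Lemma analytic_opp a b F : analytic_family a b F ->
  analytic_family a b (fun X t => - F X t).
Proof.
intros [u [[Cu [Bu [Pu Hu]]] Fu]].
exists (fun X => PS_opp (u X)); split; [split|].
- intros n X HX; apply (continuous_opp (fun Y => u Y n)); now apply Cu.
- exists Bu; split; [lra|]; intros X HX N.
  apply Rle_trans with (2 := Hu X HX N), Req_le, sum_eq; intros n _.
  now rewrite <- (Rabs_Ropp (u X n)).
- intros X t HX Ht; apply (is_pseries_opp (u X)); now apply Fu.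
Qed.

Lemma analytic_minus a b F H : analytic_family a b F -> analytic_family a b H ->
  analytic_family a b (fun X t => F X t - H X t).
Proof. intros; apply analytic_plus; [|apply analytic_opp]; assumption. Qed.

Lemma analytic_pow a b F n : analytic_family a b F ->
  analytic_family a b (fun X t => F X t ^ n).
Proof.
intros HF; induction n as [|n IH]; simpl.
- apply (analytic_const a b (fun _ => 1)); intros; apply continuous_const.
- now apply analytic_mult.
Qed.

Lemma pseries_at_0 (s : nat -> R) l : is_pseries s 0 l -> s 0%nat = l.
Proof.
intros H; rewrite <- (is_pseries_unique _ _ _ H); symmetry; apply PSeries_0.
Qed.

(** * Recursive construction of the coefficients *)

Definition trunc (n : nat) (u : nat -> R) (k : nat) : R :=
  if (k <? n)%nat then u k else 0.

(** Course-of-values recursion made structural: stage n holds the first n terms and is 0 afterwards,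
    so [Phi n] is shown exactly the earlier terms. *)
Fixpoint rec_prefix (Phi : nat -> (nat -> R) -> R) (n : nat) : nat -> R :=
  match n with
  | 0%nat => fun _ => 0
  | S p => fun k => if (k =? p)%nat then Phi p (rec_prefix Phi p)
                    else rec_prefix Phi p k
  end.

Definition rec_seq (Phi : nat -> (nat -> R) -> R) (n : nat) : R :=
  rec_prefix Phi (S n) n.

Lemma rec_prefix_trunc Phi n k : rec_prefix Phi n k = trunc n (rec_seq Phi) k.
Proof.
unfold trunc; induction n as [|n IH]; [reflexivity|].
simpl; destruct (Nat.eqb_spec k n) as [->|Hk].
- replace (n <? S n)%nat with true by (symmetry; apply Nat.ltb_lt; lia).
  unfold rec_seq; simpl; now rewrite Nat.eqb_refl.
- rewrite IH; destruct (Nat.ltb_spec k n), (Nat.ltb_spec k (S n)); auto; lia.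
Qed.

Lemma rec_seq_eq Phi n :
  (forall u v, (forall k, u k = v k) -> Phi n u = Phi n v) ->
  rec_seq Phi n = Phi n (trunc n (rec_seq Phi)).
Proof.
intros Hext; unfold rec_seq at 1; simpl; rewrite Nat.eqb_refl.
apply Hext; intros k; apply rec_prefix_trunc.
Qed.

(** * Coefficients of the Briot-Bouquet equation and their majorant *)

Definition theta (u : nat -> R) (n : nat) : R := INR n * u n.
Definition drop0 (s : nat -> R) (n : nat) : R :=
  match n with 0%nat => 0 | S _ => s n end.

Lemma PS_mult_drop0 s w n : PS_mult s w n = s 0%nat * w n + PS_mult (drop0 s) w n.
Proof.
unfold PS_mult; destruct n as [|n]; [simpl; ring|].
rewrite !(decomp_sum (fun k => _ * w (S n - k)%nat)) by lia; simpl; ring.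
Qed.

Lemma PS_mult_agree a a' b b' n :
  (forall k, (k <= n)%nat -> a k = a' k) -> (forall k, (k <= n)%nat -> b k = b' k) ->
  PS_mult a b n = PS_mult a' b' n.
Proof. intros Ha Hb; apply sum_eq; intros k Hk; rewrite Ha, Hb; auto; lia. Qed.

(** The two end terms of the convolution contain a factor of order 0, which vanishes; only orders 1
    to n - 1 remain. *)
Lemma PS_mult_agree_lt a a' b b' n :
  a 0%nat = 0 -> a' 0%nat = 0 -> b 0%nat = 0 -> b' 0%nat = 0 ->
  (forall k, (k < n)%nat -> a k = a' k) -> (forall k, (k < n)%nat -> b k = b' k) ->
  forall k, (k <= n)%nat -> PS_mult a b k = PS_mult a' b' k.
Proof.
intros H1 H2 H3 H4 Ha Hb k Hk; apply sum_eq; intros i Hi.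
destruct (Nat.eq_dec i 0) as [->|Hi0]; [rewrite H1, H2; ring|].
destruct (Nat.eq_dec i k) as [->|Hik].
- replace (k - k)%nat with 0%nat by lia; rewrite H3, H4; ring.
- rewrite Ha, Hb by lia; ring.
Qed.

Lemma PS_mult_0 a b : a 0%nat = 0 -> PS_mult a b 0%nat = 0.
Proof. intros H; unfold PS_mult; simpl; rewrite H; ring. Qed.

(** Order n of (g0 + g1 w + g2 w^2) t w' = k0 + k1 w + k2 w^2 + k3 w^3, where [theta] is the
    operator t d/dt. The constant terms of [k1] and [g0] are taken out by [drop0]: their
    contribution, [w n] times the divisor n g0(0) - k1(0), stays on the other side. *)
Definition bb_rhs (k0 k1 k2 k3 g0 g1 g2 w : nat -> R) (n : nat) : R :=
  k0 n + PS_mult (drop0 k1) w n + PS_mult k2 (PS_mult w w) n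
  + PS_mult k3 (PS_mult (PS_mult w w) w) n
  - PS_mult (drop0 g0) (theta w) n - PS_mult g1 (PS_mult w (theta w)) n
  - PS_mult g2 (PS_mult (PS_mult w w) (theta w)) n.

(** The term [w n] could enter only next to a constant term removed by [drop0], or next to an
    order-0 factor [w 0] or [theta w 0] inside a quadratic or cubic product, and these vanish. *)
Lemma bb_rhs_agree k0 k1 k2 k3 g0 g1 g2 w w' n :
  w 0%nat = 0 -> w' 0%nat = 0 -> (forall k, (k < n)%nat -> w k = w' k) ->
  bb_rhs k0 k1 k2 k3 g0 g1 g2 w n = bb_rhs k0 k1 k2 k3 g0 g1 g2 w' n.
Proof.
intros H0 H0' H.
assert (Ht : forall k, (k < n)%nat -> theta w k = theta w' k).
{ intros k Hk; unfold theta; now rewrite H. }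
assert (Ht0 : theta w 0%nat = 0) by (unfold theta; simpl; ring).
assert (Ht0' : theta w' 0%nat = 0) by (unfold theta; simpl; ring).
assert (Hww : forall k, (k <= n)%nat -> PS_mult w w k = PS_mult w' w' k)
  by now apply PS_mult_agree_lt.
assert (Hww' : forall k, (k < n)%nat -> PS_mult w w k = PS_mult w' w' k)
  by (intros; apply Hww; lia).
unfold bb_rhs;
  repeat first [apply (f_equal2 Rminus) | apply (f_equal2 Rplus)]; [reflexivity| | | | | |].
- apply PS_mult_agree_lt with n; auto.
- apply PS_mult_agree; auto.
- apply PS_mult_agree; auto; apply PS_mult_agree_lt; auto; now apply PS_mult_0.
- apply PS_mult_agree_lt with n; auto.
- apply PS_mult_agree; auto; apply PS_mult_agree_lt; auto.
- apply PS_mult_agree; auto; apply PS_mult_agree_lt; auto; now apply PS_mult_0.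
Qed.

Definition bb_coef (k0 k1 k2 k3 g0 g1 g2 : nat -> R) : nat -> R :=
  rec_seq (fun n u => match n with 0%nat => 0 | S _ =>
    bb_rhs k0 k1 k2 k3 g0 g1 g2 u n / (INR n * g0 0%nat - k1 0%nat) end).

Lemma bb_rhs_ext k0 k1 k2 k3 g0 g1 g2 w w' n : (forall k, w k = w' k) ->
  bb_rhs k0 k1 k2 k3 g0 g1 g2 w n = bb_rhs k0 k1 k2 k3 g0 g1 g2 w' n.
Proof.
intros H.
assert (Hww : forall k, PS_mult w w k = PS_mult w' w' k)
  by (intros; now apply PS_mult_agree).
assert (Ht : forall k, theta w k = theta w' k) by (intros; unfold theta; now rewrite H).
unfold bb_rhs;
  repeat first [apply (f_equal2 Rminus) | apply (f_equal2 Rplus)]; [reflexivity|..];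
  apply PS_mult_agree; auto; intros; apply PS_mult_agree; auto.
Qed.

Lemma bb_coef_trunc k0 k1 k2 k3 g0 g1 g2 n : (0 < n)%nat ->
  let w := bb_coef k0 k1 k2 k3 g0 g1 g2 in
  w n = bb_rhs k0 k1 k2 k3 g0 g1 g2 (trunc n w) n / (INR n * g0 0%nat - k1 0%nat).
Proof.
intros Hn w; unfold w at 1, bb_coef; rewrite rec_seq_eq.
- destruct n as [|n]; [lia|reflexivity].
- intros u v Huv; destruct n as [|n]; [reflexivity|].
  f_equal; now apply bb_rhs_ext.
Qed.

Lemma trunc_lt n u k : (k < n)%nat -> trunc n u k = u k.
Proof. intros H; unfold trunc; now rewrite (proj2 (Nat.ltb_lt _ _) H). Qed.

Lemma trunc_0 n u : u 0%nat = 0 -> trunc n u 0%nat = 0.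
Proof. unfold trunc; destruct (0 <? n)%nat; auto. Qed.

Lemma bb_coef_eq k0 k1 k2 k3 g0 g1 g2 n : (0 < n)%nat ->
  let w := bb_coef k0 k1 k2 k3 g0 g1 g2 in
  w n = bb_rhs k0 k1 k2 k3 g0 g1 g2 w n / (INR n * g0 0%nat - k1 0%nat).
Proof.
intros Hn w; unfold w at 1; rewrite bb_coef_trunc by assumption; fold w; f_equal.
apply bb_rhs_agree; [now apply trunc_0 | reflexivity | intros; now apply trunc_lt].
Qed.

(* The factor [k] pays for the derivative: it is absorbed by the divisor [n g0 - k1]. *)
Definition dominated (x y : nat -> R) : Prop :=
  forall k, Rabs (x k) <= INR k * y k.

Lemma dominated_y_pos x y k : dominated x y -> (0 < k)%nat -> 0 <= y k.
Proof.
intros H Hk; specialize (H k).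
assert (0 < INR k) by now apply lt_0_INR.
assert (0 <= Rabs (x k)) by apply Rabs_pos.
nra.
Qed.

Lemma dominated_abs x : x 0%nat = 0 -> dominated x (fun k => Rabs (x k)).
Proof.
intros H [|k]; [rewrite H, Rabs_R0; simpl; lra|].
assert (1 <= INR (S k)) by (rewrite S_INR; generalize (pos_INR k); lra).
assert (0 <= Rabs (x (S k))) by apply Rabs_pos; nra.
Qed.

Lemma dominated_theta x : dominated (theta x) (fun k => Rabs (x k)).
Proof.
intros k; unfold theta; rewrite Rabs_mult, (Rabs_pos_eq (INR k)) by apply pos_INR; lra.
Qed.

(* [y 0] must be nonnegative: domination says nothing about it. *)
Lemma dominated_mult a x y : 0 <= y 0%nat -> dominated x y ->
  dominated (PS_mult a x) (PS_mult (fun k => Rabs (a k)) y).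
Proof.
intros Hy H n; unfold PS_mult; rewrite scal_sum.
apply Rle_trans with (1 := Rsum_abs _ _); apply sum_Rle; intros k Hk.
rewrite Rabs_mult, Rmult_assoc; apply Rmult_le_compat_l; [apply Rabs_pos|].
apply Rle_trans with (1 := H (n - k)%nat).
rewrite Rmult_comm; apply Rmult_le_compat_l; [|apply le_INR; lia].
destruct (Nat.eq_dec (n - k) 0) as [->|E]; [exact Hy|].
apply (dominated_y_pos x); [exact H|lia].
Qed.

Lemma dominated_plus x y x' y' : dominated x y -> dominated x' y' ->
  dominated (fun n => x n + x' n) (fun n => y n + y' n).
Proof.
intros H H' n; apply Rle_trans with (1 := Rabs_triang _ _).
specialize (H n); specialize (H' n); lra.
Qed.

Lemma dominated_minus x y x' y' : dominated x y -> dominated x' y' ->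
  dominated (fun n => x n - x' n) (fun n => y n + y' n).
Proof.
intros H H' n; unfold Rminus; apply Rle_trans with (1 := Rabs_triang _ _).
rewrite Rabs_Ropp; specialize (H n); specialize (H' n); lra.
Qed.

Lemma PS_mult_abs_pos a b : 0 <= b 0%nat -> 0 <= PS_mult (fun k => Rabs (a k)) b 0%nat.
Proof. intros H; unfold PS_mult; simpl; apply Rmult_le_pos; [apply Rabs_pos|exact H]. Qed.

Lemma wnorm_mult_le r a b N A B : 0 <= r -> wnorm r a N <= A -> wnorm r b N <= B ->
  wnorm r (PS_mult a b) N <= A * B.
Proof.
intros Hr HA HB; apply Rle_trans with (1 := wnorm_mult r a b N Hr).
apply Rmult_le_compat; auto; now apply wnorm_pos.
Qed.

(* Dominating sequence for [bb_rhs]: every term is at least quadratic in [w] or carries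
   a factor [t], which is what makes the majorant small. *)
Definition bb_major (k0 k1 k2 k3 g0 g1 g2 w : nat -> R) (n : nat) : R :=
  let abs u := fun k : nat => Rabs (u k) in
  Rabs (k0 n) + PS_mult (abs (drop0 k1)) (abs w) n
  + PS_mult (abs k2) (PS_mult (abs w) (abs w)) n
  + PS_mult (abs k3) (PS_mult (abs (PS_mult w w)) (abs w)) n
  + PS_mult (abs (drop0 g0)) (abs w) n + PS_mult (abs g1) (PS_mult (abs w) (abs w)) n
  + PS_mult (abs g2) (PS_mult (abs (PS_mult w w)) (abs w)) n.

Lemma bb_rhs_dominated k0 k1 k2 k3 g0 g1 g2 w : k0 0%nat = 0 -> w 0%nat = 0 ->
  dominated (bb_rhs k0 k1 k2 k3 g0 g1 g2 w) (bb_major k0 k1 k2 k3 g0 g1 g2 w).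
Proof.
intros Hk Hw.
pose proof (Rabs_pos (w 0%nat)) as Hp.
repeat first [apply dominated_minus | apply dominated_plus];
  repeat first [apply dominated_mult | apply dominated_theta];
  try (now apply dominated_abs); repeat apply PS_mult_abs_pos; exact Hp.
Qed.

Lemma wnorm_plus_le r a b N A B : 0 <= r -> wnorm r a N <= A -> wnorm r b N <= B ->
  wnorm r (fun n => a n + b n) N <= A + B.
Proof.
intros Hr HA HB; apply Rle_trans with (1 := wnorm_plus r a b N Hr); lra.
Qed.

(** The four summands come from [k0], from the linear terms of [k1] and [g0], from the quadratic
    terms of [k2] and [g1], and from the cubic terms of [k3] and [g2]. The first two gain a factor r
    because their coefficients have no constant term. *)
Lemma bb_major_norm k0 k1 k2 k3 g0 g1 g2 w N r B A :
  0 <= r <= 1 -> 0 <= B -> k0 0%nat = 0 ->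
  (forall s, s = k0 \/ s = k1 \/ s = k2 \/ s = k3 \/ s = g0 \/ s = g1 \/ s = g2 ->
     wnorm 1 s N <= B) ->
  wnorm r w N <= A ->
  wnorm r (bb_major k0 k1 k2 k3 g0 g1 g2 w) N
  <= r * B + 2 * (r * B) * A + 2 * B * (A * A) + 2 * B * (A * A * A).
Proof.
intros Hr HB Hk0 HBs HA.
assert (Hr0 : 0 <= r) by lra.
assert (HA0 : 0 <= A) by (apply Rle_trans with (2 := HA); now apply wnorm_pos).
assert (Hd : forall s, wnorm 1 s N <= B -> wnorm r (drop0 s) N <= r * B).
{ intros s Hs; apply Rle_trans with (1 := wnorm_shrink r (drop0 s) N Hr eq_refl).
  apply Rmult_le_compat_l; [lra|]; apply Rle_trans with (2 := Hs).
  apply sum_Rle; intros [|n] _; unfold drop0; [rewrite Rabs_R0; simpl|lra].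
  generalize (Rabs_pos (s 0%nat)); lra. }
assert (Hs : forall s, wnorm 1 s N <= B -> wnorm r s N <= B).
{ intros s Hs; apply Rle_trans with (2 := Hs); now apply wnorm_le_1. }
unfold bb_major.
assert (H1 : wnorm r (fun n => Rabs (k0 n)) N <= r * B).
{ rewrite wnorm_abs; apply Rle_trans with (1 := wnorm_shrink r k0 N Hr Hk0).
  apply Rmult_le_compat_l; [lra|]; apply HBs; auto. }
assert (Hw2 : wnorm r (PS_mult w w) N <= A * A) by now apply wnorm_mult_le.
eapply Rle_trans.
- repeat first [apply (wnorm_plus_le r (fun n => _) (fun n => _)); [exact Hr0| |
    repeat (apply wnorm_mult_le; [exact Hr0| |]);
    rewrite ?wnorm_abs; first [apply Hd | exact HA | exact Hw2 | apply Hs]; apply HBs; tauto] | exact H1].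
- apply Req_le; ring.
Qed.

Lemma wnorm_trunc r w N : wnorm r (trunc (S N) w) (S N) = wnorm r w N.
Proof.
unfold wnorm; rewrite tech5; unfold trunc at 2; rewrite Nat.ltb_irrefl, Rabs_R0.
rewrite Rmult_0_l, Rplus_0_r; apply sum_eq; intros n Hn.
rewrite trunc_lt; [reflexivity|lia].
Qed.

(** The smallness condition says that the majorant of a sequence of norm at most A has norm at most
    kap A; the divisors, at least n kap since k1(0) <= 0, bring this back to A. Induction on N takes
    the place of a fixed-point argument. *)
Lemma bb_coef_norm k0 k1 k2 k3 g0 g1 g2 r B A kap :
  0 < kap -> kap <= g0 0%nat -> k1 0%nat <= 0 -> k0 0%nat = 0 ->
  0 <= r <= 1 -> 0 <= B -> 0 <= A ->
  (forall s, s = k0 \/ s = k1 \/ s = k2 \/ s = k3 \/ s = g0 \/ s = g1 \/ s = g2 ->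
     forall N, wnorm 1 s N <= B) ->
  r * B + 2 * (r * B) * A + 2 * B * (A * A) + 2 * B * (A * A * A) <= kap * A ->
  forall N, wnorm r (bb_coef k0 k1 k2 k3 g0 g1 g2) N <= A.
Proof.
intros Hkap Hg0 Hk1 Hk0 Hr HB HA HBs Hsmall.
set (w := bb_coef k0 k1 k2 k3 g0 g1 g2).
assert (Hw0 : w 0%nat = 0) by reflexivity.
intros N; induction N as [|N IH].
{ unfold wnorm; simpl; rewrite Hw0, Rabs_R0; lra. }
(* Without its term of order N + 1 the sequence still determines all coefficients up to that order,
   while its norm is covered by the induction hypothesis. *)
set (u := trunc (S N) w).
assert (Hu0 : u 0%nat = 0) by now apply trunc_0.
assert (Hmaj := bb_major_norm k0 k1 k2 k3 g0 g1 g2 u (S N) r B A Hr HB Hk0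
  (fun s Hs => HBs s Hs (S N))).
assert (Hterm : forall n, (n <= S N)%nat ->
   kap * Rabs (w n) <= Rabs (bb_major k0 k1 k2 k3 g0 g1 g2 u n)).
{ intros [|n] Hn; [rewrite Hw0, Rabs_R0, Rmult_0_r; apply Rabs_pos|].
  assert (HSn : 0 < INR (S n)) by (apply lt_0_INR; lia).
  set (d := INR (S n) * g0 0%nat - k1 0%nat).
  assert (Hd : INR (S n) * kap <= d) by (unfold d; nra).
  assert (Hdp : 0 < d) by nra.
  assert (E : w (S n) = bb_rhs k0 k1 k2 k3 g0 g1 g2 u (S n) / d).
  { unfold w, d; rewrite bb_coef_trunc by lia; fold w; f_equal.
    apply bb_rhs_agree; [now apply trunc_0 | exact Hu0 |].
    intros k Hk; unfold u; rewrite !trunc_lt by lia; reflexivity. }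
  assert (Hdom := bb_rhs_dominated k0 k1 k2 k3 g0 g1 g2 u Hk0 Hu0 (S n)).
  assert (Hle := Rle_abs (bb_major k0 k1 k2 k3 g0 g1 g2 u (S n))).
  assert (E2 : Rabs (bb_rhs k0 k1 k2 k3 g0 g1 g2 u (S n)) = d * Rabs (w (S n))).
  { rewrite E; unfold Rdiv; rewrite Rabs_mult, Rabs_inv, (Rabs_pos_eq d) by lra.
    field; lra. }
  rewrite E2 in Hdom.
  assert (0 <= Rabs (w (S n))) by apply Rabs_pos.
  apply Rmult_le_reg_l with (INR (S n)); [exact HSn|].
  apply Rle_trans with (d * Rabs (w (S n))); [nra|].
  apply Rle_trans with (1 := Hdom); nra. }
assert (H1 : kap * wnorm r w (S N) <= wnorm r (bb_major k0 k1 k2 k3 g0 g1 g2 u) (S N)).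
{ unfold wnorm; rewrite scal_sum; apply sum_Rle; intros n Hn.
  rewrite (Rmult_comm _ kap), <- Rmult_assoc; apply Rmult_le_compat_r;
    [apply pow_le; lra | now apply Hterm]. }
assert (H2 : wnorm r u (S N) <= A) by (unfold u; rewrite wnorm_trunc; exact IH).
specialize (Hmaj H2).
apply Rmult_le_reg_l with kap; lra.
Qed.

Lemma bb_coef_full k0 k1 k2 k3 g0 g1 g2 n :
  k0 0%nat = 0 -> (forall n, (0 < n)%nat -> INR n * g0 0%nat - k1 0%nat <> 0) ->
  let w := bb_coef k0 k1 k2 k3 g0 g1 g2 in
  k0 n + PS_mult k1 w n + PS_mult k2 (PS_mult w w) n
  + PS_mult k3 (PS_mult (PS_mult w w) w) n
  - (PS_mult g0 (theta w) n + PS_mult g1 (PS_mult w (theta w)) n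
     + PS_mult g2 (PS_mult (PS_mult w w) (theta w)) n) = 0.
Proof.
intros Hk0 Hd w.
destruct n as [|n].
{ unfold PS_mult, theta; simpl; rewrite Hk0; replace (w 0%nat) with 0 by reflexivity; ring. }
rewrite (PS_mult_drop0 k1), (PS_mult_drop0 g0).
assert (E := bb_coef_eq k0 k1 k2 k3 g0 g1 g2 (S n) (Nat.lt_0_succ n)).
fold w in E.
specialize (Hd (S n) (Nat.lt_0_succ n)).
assert (E2 : bb_rhs k0 k1 k2 k3 g0 g1 g2 w (S n)
   = (INR (S n) * g0 0%nat - k1 0%nat) * w (S n)).
{ rewrite E; field; exact Hd. }
unfold bb_rhs in E2; unfold theta at 1; lra.
Qed.

Lemma continuous_drop0 (s : R -> nat -> R) X :
  (forall n, continuous (fun Y => s Y n) X) ->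
  forall n, continuous (fun Y => drop0 (s Y) n) X.
Proof. intros H [|n]; [apply continuous_const | apply H]. Qed.

Lemma continuous_bb_rhs (k0 k1 k2 k3 g0 g1 g2 u : R -> nat -> R) X n :
  (forall s, s = k0 \/ s = k1 \/ s = k2 \/ s = k3 \/ s = g0 \/ s = g1 \/ s = g2 ->
     forall n, continuous (fun Y => s Y n) X) ->
  (forall n, continuous (fun Y => u Y n) X) ->
  continuous
    (fun Y => bb_rhs (k0 Y) (k1 Y) (k2 Y) (k3 Y) (g0 Y) (g1 Y) (g2 Y) (u Y) n) X.
Proof.
intros Hs Hu.
assert (Hm : forall a b : R -> nat -> R, (forall k, continuous (fun Y => a Y k) X) ->
    (forall k, continuous (fun Y => b Y k) X) ->
    forall k, continuous (fun Y => PS_mult (a Y) (b Y) k) X)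
    by (intros; now apply continuous_PS_mult).
assert (Ht : forall k, continuous (fun Y => theta (u Y) k) X).
{ intros k; apply (continuous_Rmult (fun _ => INR k)); [apply continuous_const|apply Hu]. }
assert (H2 := Hm u u Hu Hu).
unfold bb_rhs.
apply continuous_Rminus; [apply continuous_Rminus; [apply continuous_Rminus;
  [apply continuous_Rplus; [apply continuous_Rplus; [apply continuous_Rplus|]|]|]|]|].
- apply Hs; tauto.
- apply (Hm (fun Y => drop0 (k1 Y)) u); [|exact Hu].
  apply continuous_drop0; apply Hs; tauto.
- apply (Hm k2 (fun Y => PS_mult (u Y) (u Y))); [apply Hs; tauto | exact H2].
- apply (Hm k3 (fun Y => PS_mult (PS_mult (u Y) (u Y)) (u Y))); [apply Hs; tauto |].
  now apply (Hm (fun Y => PS_mult (u Y) (u Y)) u).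
- apply (Hm (fun Y => drop0 (g0 Y)) (fun Y => theta (u Y))); [|exact Ht].
  apply continuous_drop0; apply Hs; tauto.
- apply (Hm g1 (fun Y => PS_mult (u Y) (theta (u Y)))); [apply Hs; tauto |].
  now apply (Hm u (fun Y => theta (u Y))).
- apply (Hm g2 (fun Y => PS_mult (PS_mult (u Y) (u Y)) (theta (u Y))));
    [apply Hs; tauto |].
  now apply (Hm (fun Y => PS_mult (u Y) (u Y)) (fun Y => theta (u Y))).
Qed.

Lemma continuous_bb_coef (k0 k1 k2 k3 g0 g1 g2 : R -> nat -> R) X :
  (forall s, s = k0 \/ s = k1 \/ s = k2 \/ s = k3 \/ s = g0 \/ s = g1 \/ s = g2 ->
     forall n, continuous (fun Y => s Y n) X) ->
  (forall n, (0 < n)%nat -> INR n * g0 X 0%nat - k1 X 0%nat <> 0) ->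
  forall n, continuous
    (fun Y => bb_coef (k0 Y) (k1 Y) (k2 Y) (k3 Y) (g0 Y) (g1 Y) (g2 Y) n) X.
Proof.
intros Hs Hd.
set (w := fun Y => bb_coef (k0 Y) (k1 Y) (k2 Y) (k3 Y) (g0 Y) (g1 Y) (g2 Y)).
intros n; induction n as [n IH] using (well_founded_induction lt_wf).
destruct n as [|n]; [apply continuous_const|].
apply (continuous_ext (fun Y => bb_rhs (k0 Y) (k1 Y) (k2 Y) (k3 Y) (g0 Y) (g1 Y) (g2 Y)
   (trunc (S n) (w Y)) (S n) * / (INR (S n) * g0 Y 0%nat - k1 Y 0%nat))).
{ intros Y; unfold w; rewrite (bb_coef_trunc _ _ _ _ _ _ _ (S n)) by lia; reflexivity. }
apply continuous_Rmult.
- apply (continuous_bb_rhs k0 k1 k2 k3 g0 g1 g2 (fun Y => trunc (S n) (w Y)) X (S n) Hs).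
  intros k; unfold trunc; destruct (Nat.ltb_spec k (S n)).
  + now apply IH.
  + apply continuous_const.
- apply continuous_Rinv_comp; [|apply Hd; lia].
  apply continuous_Rminus; [apply continuous_Rmult; [apply continuous_const|]|];
    apply Hs; tauto.
Qed.

(** * Summing the series, and dependence of the sum on the parameter *)

Lemma is_pseries_theta w t r A : (forall N, wnorm r w N <= A) -> Rabs t < r ->
  is_pseries (theta w) t (t * PSeries (PS_derive w) t) /\
  Rbar_lt (Rabs t) (CV_radius (theta w)).
Proof.
intros HA Ht.
assert (Hlt := CV_radius_wnorm_lt r w A t HA Ht).
assert (E : forall n, PS_incr_1 (PS_derive w) n = theta w n).
{ intros [|n]; unfold theta, PS_incr_1, PS_derive, zero; simpl; [ring|reflexivity]. }
split.
- apply (is_pseries_ext _ _ _ _ E).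
  apply (is_pseries_incr_1 (PS_derive w) t (PSeries (PS_derive w) t)).
  apply PSeries_correct, CV_radius_inside; now rewrite CV_radius_derive.
- rewrite <- (CV_radius_ext _ _ E), CV_radius_incr_1, CV_radius_derive; exact Hlt.
Qed.

Lemma wnorm_of_CV_radius r a : 0 <= r -> Rbar_lt r (CV_radius a) ->
  exists A, forall N, wnorm r a N <= A.
Proof.
intros Hr H.
assert (He : ex_series (fun n => Rabs (a n * r ^ n))).
{ apply CV_disk_inside; now rewrite Rabs_pos_eq. }
exists (Series (fun n => Rabs (a n * r ^ n))); intros N.
apply Rle_trans with (sum_f_R0 (fun n => Rabs (a n * r ^ n)) N).
- apply Req_le, sum_eq; intros n _; rewrite Rabs_mult, (Rabs_pos_eq (r ^ n)); auto.
  now apply pow_le.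
- apply Series_correct, is_series_Reals in He.
  apply sum_incr; [exact He | intros; apply Rabs_pos].
Qed.

(** At a radius strictly between |t| and both radii of convergence the two norms are bounded, and
    submultiplicativity bounds the norm of the product. *)
Lemma CV_radius_PS_mult t a b : Rbar_lt (Rabs t) (CV_radius a) ->
  Rbar_lt (Rabs t) (CV_radius b) -> Rbar_lt (Rabs t) (CV_radius (PS_mult a b)).
Proof.
intros Ha Hb; pose proof (Rabs_pos t) as Hp.
assert (Hr : exists r, Rabs t < r /\ Rbar_lt r (CV_radius a) /\ Rbar_lt r (CV_radius b)).
{ revert Ha Hb; case (CV_radius a) as [x| |]; case (CV_radius b) as [y| |]; simpl;
    intros Ha Hb; try tauto.
  - exists ((Rabs t + Rmin x y) / 2); unfold Rmin; destruct (Rle_dec x y); lra.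
  - exists ((Rabs t + x) / 2); lra.
  - exists ((Rabs t + y) / 2); lra.
  - exists (Rabs t + 1); lra. }
destruct Hr as [r [Hr [Hra Hrb]]].
assert (Hr0 : 0 <= r) by lra.
destruct (wnorm_of_CV_radius r a Hr0 Hra) as [A HA].
destruct (wnorm_of_CV_radius r b Hr0 Hrb) as [B HB].
apply (CV_radius_wnorm_lt r _ (A * B)); [|exact Hr].
intros N; now apply wnorm_mult_le.
Qed.

Lemma bb_coef_pseries k0 k1 k2 k3 g0 g1 g2 r A t K0 K1 K2 K3 G0 G1 G2 :
  let w := bb_coef k0 k1 k2 k3 g0 g1 g2 in
  k0 0%nat = 0 -> (forall n, (0 < n)%nat -> INR n * g0 0%nat - k1 0%nat <> 0) ->
  (forall N, wnorm r w N <= A) -> Rabs t < r ->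
  is_pseries k0 t K0 -> is_pseries k1 t K1 -> is_pseries k2 t K2 -> is_pseries k3 t K3 ->
  is_pseries g0 t G0 -> is_pseries g1 t G1 -> is_pseries g2 t G2 ->
  (forall s, s = k1 \/ s = k2 \/ s = k3 \/ s = g0 \/ s = g1 \/ s = g2 ->
     Rbar_lt (Rabs t) (CV_radius s)) ->
  let W := PSeries w t in
  let D := t * PSeries (PS_derive w) t in
  (G0 + G1 * W + G2 * W ^ 2) * D = K0 + K1 * W + K2 * W ^ 2 + K3 * W ^ 3.
Proof.
intros w Hk0 Hd HA Ht H0 H1 H2 H3 L0 L1 L2 Hs W D.
assert (Hfull : forall n, _ = 0) by
  exact (fun n => bb_coef_full k0 k1 k2 k3 g0 g1 g2 n Hk0 Hd).
fold w in Hfull; clearbody w.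
assert (Hlt := CV_radius_wnorm_lt r w A t HA Ht).
destruct (is_pseries_theta w t r A HA Ht) as [HD HDlt]; fold D in HD.
assert (HW : is_pseries w t W) by now apply PSeries_correct, CV_radius_inside.
clearbody W D.
assert (Hww : Rbar_lt (Rabs t) (CV_radius (PS_mult w w))) by now apply CV_radius_PS_mult.
assert (S1 := is_pseries_mult _ _ _ _ _ H1 HW (Hs k1 ltac:(tauto)) Hlt).
assert (WW := is_pseries_mult _ _ _ _ _ HW HW Hlt Hlt).
assert (S2 := is_pseries_mult _ _ _ _ _ H2 WW (Hs k2 ltac:(tauto)) Hww).
assert (S3 := is_pseries_mult _ _ _ _ _ H3 (is_pseries_mult _ _ _ _ _ WW HW Hww Hlt)
  (Hs k3 ltac:(tauto)) (CV_radius_PS_mult _ _ _ Hww Hlt)).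
assert (T0 := is_pseries_mult _ _ _ _ _ L0 HD (Hs g0 ltac:(tauto)) HDlt).
assert (T1 := is_pseries_mult _ _ _ _ _ L1 (is_pseries_mult _ _ _ _ _ HW HD Hlt HDlt)
  (Hs g1 ltac:(tauto)) (CV_radius_PS_mult _ _ _ Hlt HDlt)).
assert (T2 := is_pseries_mult _ _ _ _ _ L2 (is_pseries_mult _ _ _ _ _ WW HD Hww HDlt)
  (Hs g2 ltac:(tauto)) (CV_radius_PS_mult _ _ _ Hww HDlt)).
assert (U := is_pseries_plus _ _ _ _ _ (is_pseries_plus _ _ _ _ _
   (is_pseries_plus _ _ _ _ _ H0 S1) S2) S3).
assert (V := is_pseries_plus _ _ _ _ _ (is_pseries_plus _ _ _ _ _ T0 T1) T2).
assert (Z := is_pseries_minus _ _ _ _ _ U V).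
assert (Z0 : is_pseries (fun _ => 0) t 0) by apply is_pseries_zero.
assert (E := is_pseries_unique _ _ _ Z).
rewrite (PSeries_ext _ (fun _ => 0)) in E.
- rewrite (is_pseries_unique _ _ _ Z0) in E; unfold plus, opp in E; simpl in E.
  nra.
- intros n; rewrite <- (Hfull n); unfold PS_minus, PS_plus, PS_opp, plus, opp; simpl.
  ring.
Qed.

(** Continuity relative to the interval, because the uniform bounds hold only there; composition
    with [clampI] later turns it into continuity on the whole line. *)
Definition continuous_within (a b : R) (f : R -> R) : Prop :=
  forall X, a <= X <= b -> forall eps, 0 < eps -> exists eta, 0 < eta /\
    forall Y, a <= Y <= b -> Rabs (Y - X) < eta -> Rabs (f Y - f X) < eps.

(** With q = |t| / r <= 1 one has |t|^n = q^n r^n <= q^N r^n for n >= N, so the factor q^N comes out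
    of the tail and the norm bounds the rest. *)
Lemma partial_sum_tail w t r A N M : 0 < r -> Rabs t < r ->
  (forall N, wnorm r w N <= A) -> (N <= M)%nat ->
  Rabs (sum_f_R0 (fun n => w n * t ^ n) M - sum_f_R0 (fun n => w n * t ^ n) N)
  <= (Rabs t / r) ^ N * A.
Proof.
intros Hr Ht HA HNM.
set (q := Rabs t / r).
assert (Hq : 0 <= q <= 1).
{ unfold q; split; [apply Rmult_le_pos; [apply Rabs_pos|left; now apply Rinv_0_lt_compat]|].
  apply Rmult_le_reg_r with r; [exact Hr|]; field_simplify; lra. }
assert (Hgen : Rabs (sum_f_R0 (fun n => w n * t ^ n) M - sum_f_R0 (fun n => w n * t ^ n) N)
   <= q ^ N * (wnorm r w M - wnorm r w N)).
{ induction HNM as [|M HNM IH].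
  - rewrite !Rminus_diag, Rabs_R0; lra.
  - rewrite tech5; unfold wnorm at 1; rewrite tech5; fold (wnorm r w M).
    replace (_ + w (S M) * t ^ S M - _) with
      ((sum_f_R0 (fun n => w n * t ^ n) M - sum_f_R0 (fun n => w n * t ^ n) N)
        + w (S M) * t ^ S M) by ring.
    apply Rle_trans with (1 := Rabs_triang _ _).
    assert (Rabs (w (S M) * t ^ S M) <= q ^ N * (Rabs (w (S M)) * r ^ S M)).
    { rewrite Rabs_mult, <- RPow_abs.
      replace (Rabs t) with (q * r) by (unfold q; field; lra).
      rewrite Rpow_mult_distr.
      assert (q ^ S M <= q ^ N).
      { replace (S M) with (N + (S M - N))%nat by lia; rewrite pow_add.
        assert (0 <= q ^ N) by (apply pow_le; lra).
        assert (q ^ (S M - N) <= 1 ^ (S M - N)) by (apply pow_incr; lra).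
        rewrite pow1 in H0; nra. }
      assert (0 <= Rabs (w (S M)) * r ^ S M).
      { apply Rmult_le_pos; [apply Rabs_pos | apply pow_le; lra]. }
      nra. }
    lra. }
apply Rle_trans with (1 := Hgen), Rmult_le_compat_l; [apply pow_le; lra|].
specialize (HA M); assert (0 <= wnorm r w N) by (apply wnorm_pos; lra); lra.
Qed.

Lemma PSeries_tail w t r A N : 0 < r -> Rabs t < r ->
  (forall N, wnorm r w N <= A) ->
  Rabs (PSeries w t - sum_f_R0 (fun n => w n * t ^ n) N) <= (Rabs t / r) ^ N * A.
Proof.
intros Hr Ht HA.
assert (Hlt := CV_radius_wnorm_lt r w A t HA Ht).
assert (H := PSeries_correct w t (CV_radius_inside _ _ Hlt)).
apply is_pseries_R, is_series_Reals in H.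
set (s := sum_f_R0 (fun n => w n * t ^ n) N).
set (e := (Rabs t / r) ^ N * A).
destruct (Rle_or_lt (Rabs (PSeries w t - s)) e) as [|Hc]; [assumption|exfalso].
destruct (H (Rabs (PSeries w t - s) - e)) as [M HM]; [lra|].
specialize (HM (max M N) (Nat.le_max_l _ _)).
assert (HN := partial_sum_tail w t r A N (max M N) Hr Ht HA (Nat.le_max_r _ _)).
fold s e in HN; unfold Rdist in HM.
set (p := sum_f_R0 (fun n => w n * t ^ n) (max M N)) in *.
assert (Rabs (PSeries w t - s) <= Rabs (p - PSeries w t) + Rabs (p - s)).
{ replace (PSeries w t - s) with (- (p - PSeries w t) + (p - s)) by ring.
  apply Rle_trans with (1 := Rabs_triang _ _); rewrite Rabs_Ropp; lra. }
lra.
Qed.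

Lemma PSeries_bound w t r A : 0 < r -> Rabs t < r ->
  (forall N, wnorm r w N <= A) -> w 0%nat = 0 -> Rabs (PSeries w t) <= A.
Proof.
intros Hr Ht HA H0.
assert (H := PSeries_tail w t r A 0 Hr Ht HA); simpl in H.
rewrite H0 in H; rewrite Rmult_1_l, Rmult_0_l, Rminus_0_r in H; exact H.
Qed.

(** One partial sum is continuous in X as a finite sum, and the two tails are small uniformly in X;
    each of the three takes eps / 3. *)
Lemma PSeries_continuous_within a b (W : R -> nat -> R) t r A : 0 < r -> Rabs t < r ->
  (forall n X, a <= X <= b -> continuous (fun Y => W Y n) X) ->
  (forall X, a <= X <= b -> forall N, wnorm r (W X) N <= A) ->
  continuous_within a b (fun X => PSeries (W X) t).
Proof.
intros Hr Ht HC HA X HX eps Heps.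
assert (Hq : Rabs (Rabs t / r) < 1).
{ rewrite Rabs_pos_eq.
  - apply Rmult_lt_reg_r with r; [exact Hr|]; field_simplify; lra.
  - apply Rmult_le_pos; [apply Rabs_pos|left; now apply Rinv_0_lt_compat]. }
assert (HA0 : 0 <= A).
{ apply Rle_trans with (2 := HA X HX 0%nat); apply wnorm_pos; lra. }
destruct (pow_lt_1_zero _ Hq (eps / 3 / (A + 1))) as [N HN].
{ repeat apply Rdiv_lt_0_compat; lra. }
specialize (HN N (Nat.le_refl N)).
assert (Htail : forall Z, a <= Z <= b ->
  Rabs (PSeries (W Z) t - sum_f_R0 (fun n => W Z n * t ^ n) N) < eps / 3).
{ intros Z HZ; apply Rle_lt_trans with (1 := PSeries_tail (W Z) t r A N Hr Ht (HA Z HZ)).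
  apply Rle_lt_trans with (Rabs ((Rabs t / r) ^ N) * A).
  - apply Rmult_le_compat_r; [exact HA0 | apply Rle_abs].
  - apply Rle_lt_trans with (eps / 3 / (A + 1) * A); [apply Rmult_le_compat_r; lra|].
    apply Rmult_lt_reg_r with (A + 1); [lra|]; field_simplify; [nra|lra]. }
assert (HS : continuous (fun Y => sum_f_R0 (fun n => W Y n * t ^ n) N) X).
{ assert (Ht1 : forall n, continuous (fun Y => W Y n * t ^ n) X).
  { intros n; apply continuous_Rmult; [now apply HC | apply continuous_const]. }
  induction N as [|M IH] in |- *; [apply Ht1|].
  apply (continuous_Rplus (fun Y => sum_f_R0 (fun n => W Y n * t ^ n) M)); [exact IH|apply Ht1]. }
assert (He3 : 0 < eps / 3) by lra.
destruct (proj1 (filterlim_locally _ _) HS (mkposreal _ He3)) as [d Hd].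
exists d; split; [apply cond_pos|]; intros Y HY HYX.
assert (H1 := Htail Y HY); assert (H2 := Htail X HX).
assert (H3 : Rabs (sum_f_R0 (fun n => W Y n * t ^ n) N
    - sum_f_R0 (fun n => W X n * t ^ n) N) < eps / 3) by exact (Hd Y HYX).
set (sY := sum_f_R0 (fun n => W Y n * t ^ n) N) in *.
set (sX := sum_f_R0 (fun n => W X n * t ^ n) N) in *.
apply Rabs_def2 in H1; apply Rabs_def2 in H2; apply Rabs_def2 in H3.
apply Rabs_def1; lra.
Qed.

(** The radius depends only on [kap], [A0] and the uniform norms of the coefficients, so it serves
    all X. The free bound [A0] allows the correction w to be kept smaller than the slope that it
    perturbs. *)
Theorem briot_bouquet_family a b (k0 k1 k2 k3 g0 g1 g2 : R -> R -> R) kap A0 :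
  analytic_family a b k0 -> analytic_family a b k1 -> analytic_family a b k2 ->
  analytic_family a b k3 -> analytic_family a b g0 -> analytic_family a b g1 ->
  analytic_family a b g2 ->
  0 < kap -> 0 < A0 ->
  (forall X, a <= X <= b -> k0 X 0 = 0 /\ k1 X 0 <= 0 /\ kap <= g0 X 0) ->
  exists r W, 0 < r <= 1 /\
    (forall n X, a <= X <= b -> continuous (fun Y => W Y n) X) /\
    (forall X, W X 0%nat = 0) /\
    (forall X, a <= X <= b -> forall N, wnorm r (W X) N <= A0) /\
    (forall X t, a <= X <= b -> Rabs t < r ->
       let w := PSeries (W X) t in
       (g0 X t + g1 X t * w + g2 X t * w ^ 2) * (t * PSeries (PS_derive (W X)) t)
       = k0 X t + k1 X t * w + k2 X t * w ^ 2 + k3 X t * w ^ 3).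
Proof.
intros [s0 [[C0 [B0 [P0 H0]]] F0]] [s1 [[C1 [B1 [P1 H1]]] F1]]
  [s2 [[C2 [B2 [P2 H2]]] F2]] [s3 [[C3 [B3 [P3 H3]]] F3]]
  [h0 [[D0 [E0 [Q0 I0]]] L0]] [h1 [[D1 [E1 [Q1 I1]]] L1]]
  [h2 [[D2 [E2 [Q2 I2]]] L2]] Hkap HA0 Hat0.
set (B := B0 + B1 + B2 + B3 + E0 + E1 + E2 + 1).
assert (HB : 1 <= B) by (unfold B; lra).
(* As A <= 1, the quadratic and cubic terms add up to at most 4 B A^2, and 8 B A <= kap makes this
   half of kap A. *)
set (A := Rmin (Rmin A0 1) (kap / (8 * B))).
assert (HA : 0 < A /\ A <= A0 /\ A <= 1 /\ A <= kap / (8 * B)).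
{ assert (0 < kap / (8 * B)) by (apply Rdiv_lt_0_compat; lra).
  unfold A; repeat apply conj.
  - repeat apply Rmin_glb_lt; lra.
  - apply Rle_trans with (1 := Rmin_l _ _), Rmin_l.
  - apply Rle_trans with (1 := Rmin_l _ _), Rmin_r.
  - apply Rmin_r. }
destruct HA as [HAp [HA1 [HA2 HA3]]].
(* The terms with a factor r get the other half: r B + 2 r B A <= 3 r B <= kap A / 2. *)
set (r := Rmin 1 (kap * A / (6 * B))).
assert (Hr : 0 < r /\ r <= 1 /\ r <= kap * A / (6 * B)).
{ unfold r; repeat apply conj; [|apply Rmin_l|apply Rmin_r].
  apply Rmin_glb_lt; [lra|]; apply Rdiv_lt_0_compat; nra. }
destruct Hr as [Hrp [Hr1 Hr2]].
assert (HA3' : 8 * B * A <= kap).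
{ apply Rmult_le_reg_r with (/ (8 * B)); [apply Rinv_0_lt_compat; lra|].
  apply Rle_trans with (2 := HA3); right; field; lra. }
assert (Hr2' : 6 * B * r <= kap * A).
{ apply Rmult_le_reg_r with (/ (6 * B)); [apply Rinv_0_lt_compat; lra|].
  apply Rle_trans with (2 := Hr2); right; field; lra. }
assert (Hsmall : r * B + 2 * (r * B) * A + 2 * B * (A * A) + 2 * B * (A * A * A) <= kap * A).
{ assert (0 < r * B) by nra.
  assert (r * B * A <= r * B) by nra.
  assert (8 * B * A * A <= kap * A) by nra.
  assert (B * (A * A * A) <= B * (A * A)).
  { assert (0 < B * (A * A)) by (apply Rmult_lt_0_compat; nra); nra. }
  nra. }
assert (Hzero : forall X, a <= X <= b ->
   s0 X 0%nat = 0 /\ s1 X 0%nat <= 0 /\ kap <= h0 X 0%nat).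
{ intros X HX; assert (H01 : Rabs 0 < 1) by (rewrite Rabs_R0; lra).
  rewrite (pseries_at_0 _ _ (F0 X 0 HX H01)), (pseries_at_0 _ _ (F1 X 0 HX H01)),
    (pseries_at_0 _ _ (L0 X 0 HX H01)); now apply Hat0. }
assert (Hden : forall X, a <= X <= b -> forall n, (0 < n)%nat ->
   INR n * h0 X 0%nat - s1 X 0%nat <> 0).
{ intros X HX n Hn; destruct (Hzero X HX) as [_ [Z1 Z2]].
  assert (0 < INR n) by now apply lt_0_INR.
  nra. }
exists r, (fun X => bb_coef (s0 X) (s1 X) (s2 X) (s3 X) (h0 X) (h1 X) (h2 X)).
assert (Hnorm : forall X, a <= X <= b -> forall N,
  wnorm r (bb_coef (s0 X) (s1 X) (s2 X) (s3 X) (h0 X) (h1 X) (h2 X)) N <= A).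
{ intros X HX; destruct (Hzero X HX) as [Z0 [Z1 Z2]].
  apply bb_coef_norm with B kap; auto; try lra.
  intros s Hs N.
  destruct Hs as [->|[->|[->|[->|[->|[->| ->]]]]]];
    (eapply Rle_trans; [eauto|]; unfold B; lra). }
repeat apply conj; try assumption.
- intros n X HX; apply (continuous_bb_coef s0 s1 s2 s3 h0 h1 h2 X); [|now apply Hden].
  intros s Hs m; destruct Hs as [->|[->|[->|[->|[->|[->| ->]]]]]]; auto.
- reflexivity.
- intros X HX N; apply Rle_trans with (1 := Hnorm X HX N); exact HA1.
- intros X t HX Ht w.
  assert (Ht1 : Rabs t < 1) by lra.
  destruct (Hzero X HX) as [Z0 _].
  apply (bb_coef_pseries (s0 X) (s1 X) (s2 X) (s3 X) (h0 X) (h1 X) (h2 X) r A); auto.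
  intros s Hs; destruct Hs as [->|[->|[->|[->|[->| ->]]]]];
    eapply CV_radius_wnorm_lt; eauto.
Qed.

(** * Scalar differential equations *)

Lemma derive_nonneg_le (f df : R -> R) a b : a <= b ->
  (forall x, a <= x <= b -> is_derive f x (df x)) ->
  (forall x, a <= x <= b -> 0 <= df x) -> f a <= f b.
Proof.
intros Hab Hf Hdf.
destruct (MVT_gen f a b df) as [c [Hc E]].
- intros x Hx; apply Hf; rewrite Rmin_left, Rmax_right in Hx; lra.
- intros x Hx; apply continuity_pt_filterlim.
  apply (ex_derive_continuous f); exists (df x); apply Hf.
  rewrite Rmin_left, Rmax_right in Hx; lra.
- rewrite Rmin_left, Rmax_right in Hc by lra.
  specialize (Hdf c Hc); nra.
Qed.

Lemma lipschitz_continuous (f : R -> R) K x :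
  (forall u v, Rabs (f u - f v) <= K * Rabs (u - v)) -> continuous f x.
Proof.
intros H; apply filterlim_locally; intros eps.
assert (HK : 0 < Rabs K + 1) by (generalize (Rabs_pos K); lra).
assert (He : 0 < eps / (Rabs K + 1)) by (apply Rdiv_lt_0_compat; [apply cond_pos|lra]).
exists (mkposreal _ He); intros y Hy.
change (Rabs (y - x) < eps / (Rabs K + 1)) in Hy; change (Rabs (f y - f x) < eps).
apply Rle_lt_trans with (1 := H y x).
assert (Hp := Rabs_pos (y - x)); assert (HKK := Rle_abs K).
apply Rle_lt_trans with (Rabs (y - x) * (Rabs K + 1)); [nra|].
replace (pos eps) with (eps / (Rabs K + 1) * (Rabs K + 1)) by (field; lra).
apply Rmult_lt_compat_r; lra.
Qed.

Lemma Rmax_lipschitz c u v : Rabs (Rmax u c - Rmax v c) <= Rabs (u - v).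
Proof.
unfold Rmax; destruct (Rle_dec u c), (Rle_dec v c);
  unfold Rabs; repeat destruct Rcase_abs; lra.
Qed.

Lemma RInt_lipschitz (h : R -> R) B :
  (forall s, continuous h s) -> (forall s, Rabs (h s) <= B) ->
  forall u v, Rabs (RInt h 0 u - RInt h 0 v) <= B * Rabs (u - v).
Proof.
intros Hc HB u v.
assert (Hex : forall a b, ex_RInt h a b)
  by (intros; apply (ex_RInt_continuous (V := R_CompleteNormedModule)); auto).
assert (E : RInt h 0 v + RInt h v u = RInt h 0 u) by (apply (RInt_Chasles h); apply Hex).
replace (RInt h 0 u - RInt h 0 v) with (RInt h v u) by lra.
assert (Hgen : forall a b, a <= b -> Rabs (RInt h a b) <= B * (b - a)).
{ intros a b Hab; rewrite Rmult_comm.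
  apply (norm_RInt_le_const (V := R_NormedModule) h a b _ B Hab);
   [intros; apply HB | apply (RInt_correct (V := R_CompleteNormedModule)), Hex]. }
destruct (Rle_or_lt v u) as [H|H].
- rewrite (Rabs_pos_eq (u - v)) by lra; now apply Hgen.
- assert (E' : - RInt h u v = RInt h v u) by (apply (opp_RInt_swap h); apply Hex).
  rewrite <- E', Rabs_Ropp, (Rabs_left (u - v)) by lra.
  replace (- (u - v)) with (v - u) by ring; apply Hgen; lra.
Qed.

Lemma is_derive_RInt_continuous (h : R -> R) x :
  (forall s, continuous h s) -> is_derive (fun u => RInt h 0 u) x (h x).
Proof.
intros Hc; apply (is_derive_RInt h (fun u => RInt h 0 u) 0); [|apply Hc].
apply filter_forall; intros u; apply (RInt_correct (V := R_CompleteNormedModule)).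
apply (ex_RInt_continuous (V := R_CompleteNormedModule)); auto.
Qed.

(** Evaluation at [Rmax s 0] makes the integrand continuous on the whole line, so the integral has a
    two-sided derivative even at the initial time; the gluing at the junction relies on this. *)
Fixpoint picard (H : R -> R -> R) (l0 : R) (n : nat) : R -> R :=
  match n with
  | 0%nat => fun _ => l0
  | S p => fun t =>
      l0 + RInt (fun s => H (Rmax s 0) (picard H l0 p (Rmax s 0))) 0 t
  end.

Lemma picard_existence0 (H : R -> R -> R) B L l0 : 0 < L ->
  (forall t y, Rabs (H t y) <= B) ->
  (forall t t' y y', Rabs (H t y - H t' y') <= L * (Rabs (t - t') + Rabs (y - y'))) ->
  exists y : R -> R, y 0 = l0 /\ forall t, 0 <= t -> is_derive y t (H t (y t)).
Proof.
intros HL HB Hlip.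
assert (HB0 : 0 <= B) by (apply Rle_trans with (2 := HB 0 0); apply Rabs_pos).
assert (Hhat : forall u : R -> R,
   (forall s s', 0 <= s -> 0 <= s' -> Rabs (u s - u s') <= B * Rabs (s - s')) ->
   forall s, continuous (fun s => H (Rmax s 0) (u (Rmax s 0))) s).
{ intros u Hu s; apply (lipschitz_continuous _ (L * (1 + B))); intros a b.
  apply Rle_trans with (1 := Hlip _ _ _ _); rewrite Rmult_assoc.
  apply Rmult_le_compat_l; [lra|].
  assert (M := Rmax_lipschitz 0 a b).
  assert (U := Hu (Rmax a 0) (Rmax b 0) (Rmax_r _ _) (Rmax_r _ _)).
  assert (B * Rabs (Rmax a 0 - Rmax b 0) <= B * Rabs (a - b))
    by now apply Rmult_le_compat_l.
  lra. }
assert (HLn : forall n s s', Rabs (picard H l0 n s - picard H l0 n s') <= B * Rabs (s - s')).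
{ induction n as [|n IH]; intros s s'; simpl.
  - rewrite Rminus_diag, Rabs_R0; apply Rmult_le_pos; [exact HB0|apply Rabs_pos].
  - replace (l0 + _ - _) with
      (RInt (fun s => H (Rmax s 0) (picard H l0 n (Rmax s 0))) 0 s
       - RInt (fun s => H (Rmax s 0) (picard H l0 n (Rmax s 0))) 0 s') by ring.
    apply RInt_lipschitz; [apply Hhat; intros; apply IH | intros; apply HB]. }
assert (Hcn : forall n s, continuous (fun s => H (Rmax s 0) (picard H l0 n (Rmax s 0))) s)
  by (intros n; apply Hhat; intros; apply HLn).
assert (Hex : forall (h : R -> R) a b, (forall s, continuous h s) -> ex_RInt h a b)
  by (intros; apply (ex_RInt_continuous (V := R_CompleteNormedModule)); auto).
(* weighted sup-norm: integration against [exp (2 L s)] halves the distance *)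
assert (Hdiff : forall (u v : R -> R) D,
   (forall s, continuous (fun s => H (Rmax s 0) (u (Rmax s 0))) s) ->
   (forall s, continuous (fun s => H (Rmax s 0) (v (Rmax s 0))) s) ->
   (forall s, 0 <= s -> Rabs (u s - v s) <= D * exp (2 * L * s)) -> 0 <= D ->
   forall t, 0 <= t ->
   Rabs (RInt (fun s => H (Rmax s 0) (u (Rmax s 0))) 0 t
     - RInt (fun s => H (Rmax s 0) (v (Rmax s 0))) 0 t) <= D / 2 * exp (2 * L * t)).
{ intros u v D Hu Hv HD HD0 t Ht.
  rewrite <- (RInt_minus (V := R_CompleteNormedModule)) by now apply Hex.
  assert (Hg : is_RInt (fun s => L * D * exp (2 * L * s)) 0 t
     (D / 2 * exp (2 * L * t) - D / 2 * exp (2 * L * 0))).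
  { apply (is_RInt_derive (V := R_CompleteNormedModule) (fun s => D / 2 * exp (2 * L * s))).
    - intros x _; auto_derive; [trivial|]; field.
    - intros x _; apply (ex_derive_continuous (V := R_NormedModule)).
      auto_derive; trivial. }
  apply Rle_trans with (D / 2 * exp (2 * L * t) - D / 2 * exp (2 * L * 0)).
  2:{ rewrite Rmult_0_r, exp_0; lra. }
  apply (norm_RInt_le (V := R_NormedModule)
    (fun x => minus (H (Rmax x 0) (u (Rmax x 0))) (H (Rmax x 0) (v (Rmax x 0))))
    (fun s => L * D * exp (2 * L * s)) 0 t); auto.
  2:{ apply (RInt_correct (V := R_CompleteNormedModule)).
      apply (ex_RInt_minus (V := R_CompleteNormedModule)); now apply Hex. }
  intros x Hx; rewrite Rmax_left by lra.
  change (Rabs (H x (u x) - H x (v x)) <= L * D * exp (2 * L * x)).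
  apply Rle_trans with (1 := Hlip _ _ _ _); rewrite Rminus_diag, Rabs_R0, Rplus_0_l.
  rewrite Rmult_assoc; apply Rmult_le_compat_l; [lra|]; apply HD; lra. }
(* The first increment is at most B t = C (2 L t) <= C exp (2 L t). *)
set (C := B / (2 * L)).
assert (HC : 0 <= C) by (apply Rmult_le_pos; [lra|left; apply Rinv_0_lt_compat; lra]).
assert (Hstep : forall n t, 0 <= t ->
   Rabs (picard H l0 (S n) t - picard H l0 n t) <= C / 2 ^ n * exp (2 * L * t)).
{ induction n as [|n IH]; intros t Ht.
  - assert (E0 : RInt (fun s => H (Rmax s 0) l0) 0 0 = 0)
      by apply (RInt_point (V := R_CompleteNormedModule) 0).
    simpl.
    replace (l0 + _ - l0) with (RInt (fun s => H (Rmax s 0) l0) 0 t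
       - RInt (fun s => H (Rmax s 0) l0) 0 0) by lra.
    apply Rle_trans with (B * Rabs (t - 0));
      [apply RInt_lipschitz; [apply (Hcn 0%nat) | intros; apply HB]|].
    rewrite Rminus_0_r, Rabs_pos_eq by lra.
    replace (B * t) with (C * (2 * L * t)) by (unfold C; field; lra).
    rewrite Rdiv_1_r; apply Rmult_le_compat_l; [exact HC|].
    assert (HE := exp_ineq1_le (2 * L * t)); lra.
  - simpl picard at 1; simpl picard at 2.
    replace (l0 + _ - (l0 + _)) with
      (RInt (fun s => H (Rmax s 0) (picard H l0 (S n) (Rmax s 0))) 0 t
       - RInt (fun s => H (Rmax s 0) (picard H l0 n (Rmax s 0))) 0 t)
      by (simpl; ring).
    apply Rle_trans with (C / 2 ^ n / 2 * exp (2 * L * t)).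
    + apply Hdiff; auto; try apply Hcn.
      apply Rmult_le_pos; [exact HC | left; apply Rinv_0_lt_compat, pow_lt; lra].
    + right; simpl; field; apply pow_nonzero; lra. }
(* Telescoping: the increments C / 2^j for n <= j < n + k sum to 2 C (1 / 2^n - 1 / 2^(n + k)). *)
assert (Htail : forall n k t, 0 <= t ->
   Rabs (picard H l0 (n + k) t - picard H l0 n t)
   <= 2 * C * exp (2 * L * t) * (/ 2 ^ n - / 2 ^ (n + k))).
{ intros n k t Ht; induction k as [|k IH].
  - rewrite Nat.add_0_r, !Rminus_diag, Rabs_R0; lra.
  - rewrite Nat.add_succ_r.
    replace (picard H l0 (S (n + k)) t - picard H l0 n t) with
      ((picard H l0 (S (n + k)) t - picard H l0 (n + k) t)
       + (picard H l0 (n + k) t - picard H l0 n t)) by ring.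
    apply Rle_trans with (1 := Rabs_triang _ _).
    apply Rle_trans with (1 := Rplus_le_compat _ _ _ _ (Hstep (n + k)%nat t Ht) IH).
    right; simpl; field; split; apply pow_nonzero; lra. }
set (u := fun t => real (Lim_seq (fun n => picard H l0 n t))).
assert (Hlim : forall t, 0 <= t -> is_lim_seq (fun n => picard H l0 n t) (u t)).
{ intros t Ht; apply Lim_seq_correct', ex_lim_seq_cauchy_corr; intros eps.
  set (D := 2 * C * exp (2 * L * t)).
  assert (HD : 0 <= D) by (apply Rmult_le_pos; [lra|left; apply exp_pos]).
  destruct (pow_lt_1_zero (/ 2)) with (y := eps / 2 / (D + 1)) as [N HN].
  { rewrite Rabs_pos_eq; lra. }
  { repeat apply Rdiv_lt_0_compat; try lra; apply cond_pos. }
  specialize (HN N (Nat.le_refl N)).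
  assert (HpN : 0 < / 2 ^ N) by (apply Rinv_0_lt_compat, pow_lt; lra).
  rewrite pow_inv, Rabs_pos_eq in HN by lra.
  assert (Hsm : D * / 2 ^ N < eps / 2).
  { apply Rle_lt_trans with ((D + 1) * / 2 ^ N); [nra|].
    replace (eps / 2) with ((D + 1) * (eps / 2 / (D + 1))) by (field; lra).
    apply Rmult_lt_compat_l; lra. }
  assert (Hn : forall n, (N <= n)%nat ->
    Rabs (picard H l0 n t - picard H l0 N t) < eps / 2).
  { intros n Hn; replace n with (N + (n - N))%nat by lia.
    apply Rle_lt_trans with (1 := Htail N (n - N)%nat t Ht); fold D.
    apply Rle_lt_trans with (2 := Hsm), Rmult_le_compat_l; [exact HD|].
    assert (0 < / 2 ^ (N + (n - N))) by (apply Rinv_0_lt_compat, pow_lt; lra); lra. }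
  exists N; intros n m Hnn Hm.
  assert (h1 := Hn n Hnn); assert (h2 := Hn m Hm).
  apply Rabs_def2 in h1; apply Rabs_def2 in h2; apply Rabs_def1; lra. }
assert (Hclose : forall n t, 0 <= t ->
   Rabs (picard H l0 n t - u t) <= 2 * C / 2 ^ n * exp (2 * L * t)).
{ intros n t Ht.
  assert (Hl : is_lim_seq (fun k => Rabs (picard H l0 n t - picard H l0 (k + n) t))
     (Rabs (picard H l0 n t - u t))).
  { apply is_lim_seq_abs with (l := Finite (picard H l0 n t - u t)).
    apply is_lim_seq_minus'; [apply is_lim_seq_const|].
    apply (is_lim_seq_incr_n (fun k => picard H l0 k t)); now apply Hlim. }
  apply (is_lim_seq_le _ (fun _ => 2 * C / 2 ^ n * exp (2 * L * t)) _ _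
    ) with (2 := Hl) (3 := is_lim_seq_const _).
  intros k; rewrite Rabs_minus_sym, Nat.add_comm.
  apply Rle_trans with (1 := Htail n k t Ht).
  assert (0 < / 2 ^ (n + k)) by (apply Rinv_0_lt_compat, pow_lt; lra).
  assert (0 <= 2 * C * exp (2 * L * t))
    by (apply Rmult_le_pos; [lra|left; apply exp_pos]).
  unfold Rdiv; nra. }
assert (HuL : forall s s', 0 <= s -> 0 <= s' -> Rabs (u s - u s') <= B * Rabs (s - s')).
{ intros s s' Hs Hs'.
  assert (Hl : is_lim_seq (fun n => Rabs (picard H l0 n s - picard H l0 n s'))
     (Rabs (u s - u s'))).
  { apply is_lim_seq_abs with (l := Finite (u s - u s')).
    apply is_lim_seq_minus'; now apply Hlim. }
  apply (is_lim_seq_le _ (fun _ => B * Rabs (s - s')) _ _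
    ) with (2 := Hl) (3 := is_lim_seq_const _).
  intros n; apply HLn. }
set (h := fun s => H (Rmax s 0) (u (Rmax s 0))).
assert (Hh : forall s, continuous h s) by now apply Hhat.
assert (Hfix : forall t, 0 <= t -> u t = l0 + RInt h 0 t).
{ intros t Ht.
  assert (H1 : is_lim_seq (fun n => picard H l0 (S n) t) (u t))
    by (apply (is_lim_seq_incr_1 (fun n => picard H l0 n t)); now apply Hlim).
  assert (H2 : is_lim_seq (fun n => picard H l0 (S n) t) (l0 + RInt h 0 t)).
  { apply is_lim_seq_spec; intros eps.
    set (D := C * exp (2 * L * t)).
    assert (HD : 0 <= D) by (apply Rmult_le_pos; [lra|left; apply exp_pos]).
    destruct (pow_lt_1_zero (/ 2)) with (y := eps / (D + 1)) as [N HN].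
    { rewrite Rabs_pos_eq; lra. }
    { apply Rdiv_lt_0_compat; try lra; apply cond_pos. }
    exists N; intros n Hn; specialize (HN n Hn).
    assert (HpN : 0 < / 2 ^ n) by (apply Rinv_0_lt_compat, pow_lt; lra).
    rewrite pow_inv, Rabs_pos_eq in HN by lra.
    simpl picard.
    replace (l0 + _ - _) with
      (RInt (fun s => H (Rmax s 0) (picard H l0 n (Rmax s 0))) 0 t - RInt h 0 t) by ring.
    apply Rle_lt_trans with (2 * C / 2 ^ n / 2 * exp (2 * L * t)).
    - apply Hdiff; auto.
      apply Rmult_le_pos; [lra | left; apply Rinv_0_lt_compat, pow_lt; lra].
    - replace (2 * C / 2 ^ n / 2 * exp (2 * L * t)) with (D * / 2 ^ n)
        by (unfold D; field; apply pow_nonzero; lra).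
      apply Rle_lt_trans with ((D + 1) * / 2 ^ n); [nra|].
      replace (pos eps) with ((D + 1) * (eps / (D + 1))) by (field; lra).
      apply Rmult_lt_compat_l; lra. }
  apply is_lim_seq_unique in H1; apply is_lim_seq_unique in H2.
  rewrite H1 in H2; now inversion H2. }
(* The integral, not the limit [u], is the witness: convergence of the iterates is established for t
   >= 0 only, whereas the integral is differentiable from both sides at 0. *)
exists (fun t => l0 + RInt h 0 t); split.
- assert (E0 : RInt h 0 0 = 0) by apply (RInt_point (V := R_CompleteNormedModule) 0).
  lra.
- intros t Ht.
  assert (Ed := is_derive_RInt_continuous h t Hh).
  assert (Ef : h t = H t (l0 + RInt h 0 t)).
  { unfold h at 1; rewrite Rmax_left by lra; now rewrite (Hfix t Ht). }
  rewrite <- Ef.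
  assert (Eg := is_derive_plus (fun _ => l0) (fun t => RInt h 0 t) t _ _
    (is_derive_const l0 t) Ed).
  unfold plus, zero in Eg; simpl in Eg; rewrite Rplus_0_l in Eg; exact Eg.
Qed.

Lemma picard_existence (H : R -> R -> R) B L t0 l0 : 0 < L ->
  (forall t y, Rabs (H t y) <= B) ->
  (forall t t' y y', Rabs (H t y - H t' y') <= L * (Rabs (t - t') + Rabs (y - y'))) ->
  exists y : R -> R, y t0 = l0 /\ forall t, t0 <= t -> is_derive y t (H t (y t)).
Proof.
intros HL HB Hlip.
destruct (picard_existence0 (fun t y => H (t + t0) y) B L l0 HL) as [y [Hy0 Hy]].
- intros; apply HB.
- intros t t' u v.
  replace (t - t') with ((t + t0) - (t' + t0)) by ring; apply Hlip.
- exists (fun t => y (t - t0)); split; [now rewrite Rminus_diag|].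
  intros t Ht.
  assert (D := Hy (t - t0) ltac:(lra)).
  replace (t - t0 + t0) with t in D by ring.
  assert (E := is_derive_comp y (fun t => t - t0) t _ 1 D).
  unfold scal in E; simpl in E; unfold mult in E; simpl in E; rewrite Rmult_1_l in E.
  apply E; auto_derive; [trivial|ring].
Qed.

(** The square of the difference d is differentiable where its absolute value need not be. Adding
    e^2 absorbs the forcing: 2 |d| (L |d| + e) <= (2 L + 1) (d^2 + e^2), so (d^2 + e^2) exp (- (2 L
    + 1) t) does not increase. *)
Lemma gronwall (y1 y2 f1 f2 : R -> R) L e t0 t1 : 0 <= L -> t0 <= t1 ->
  (forall t, t0 <= t <= t1 -> is_derive y1 t (f1 t)) ->
  (forall t, t0 <= t <= t1 -> is_derive y2 t (f2 t)) ->
  (forall t, t0 <= t <= t1 -> Rabs (f1 t - f2 t) <= L * Rabs (y1 t - y2 t) + e) ->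
  (y1 t1 - y2 t1) ^ 2 <=
    ((y1 t0 - y2 t0) ^ 2 + e ^ 2) * exp ((2 * L + 1) * (t1 - t0)).
Proof.
intros HL Ht H1 H2 Hf.
set (k := 2 * L + 1).
set (E := fun t => - (((y1 t - y2 t) ^ 2 + e ^ 2) * exp (- k * t))).
set (dE := fun t => (k * ((y1 t - y2 t) ^ 2 + e ^ 2)
   - 2 * (y1 t - y2 t) * (f1 t - f2 t)) * exp (- k * t)).
assert (HE : E t0 <= E t1).
{ apply (derive_nonneg_le E dE t0 t1 Ht).
  - intros t Htt; unfold E, dE.
    assert (D1 := H1 t Htt); assert (D2 := H2 t Htt).
    assert (X1 : ex_derive y1 t) by (eexists; eauto).
    assert (X2 : ex_derive y2 t) by (eexists; eauto).
    auto_derive; [tauto|].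
    assert (E1 : Derive (fun x : R => y1 x) t = f1 t) by exact (is_derive_unique y1 t _ D1).
    assert (E2 : Derive (fun x : R => y2 x) t = f2 t) by exact (is_derive_unique y2 t _ D2).
    rewrite E1, E2; ring.
  - intros t Htt; unfold dE; apply Rmult_le_pos; [|left; apply exp_pos].
    specialize (Hf t Htt); set (d := y1 t - y2 t) in *; set (q := f1 t - f2 t) in *.
    assert (Hd : 0 <= Rabs d) by apply Rabs_pos.
    assert (Hsq : Rabs d * Rabs d = d ^ 2) by (rewrite <- Rabs_mult, Rabs_pos_eq; nra).
    assert (d * q <= Rabs d * (L * Rabs d + e)).
    { apply Rle_trans with (1 := Rle_abs _); rewrite Rabs_mult.
      now apply Rmult_le_compat_l. }
    assert (0 <= (Rabs d - e) ^ 2) by apply pow2_ge_0.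
    unfold k; nra. }
unfold E in HE.
replace (exp (k * (t1 - t0))) with (exp (- k * t0) * exp (k * t1))
  by (rewrite <- exp_plus; f_equal; ring).
assert (Hp := exp_pos (k * t1)).
assert (Hinv : exp (- k * t1) * exp (k * t1) = 1)
  by (rewrite <- exp_plus, <- exp_0; f_equal; ring).
assert (0 <= e ^ 2) by apply pow2_ge_0.
set (d1 := (y1 t1 - y2 t1) ^ 2) in *; set (d0 := (y1 t0 - y2 t0) ^ 2) in *.
apply Rle_trans with ((d1 + e ^ 2) * (exp (- k * t1) * exp (k * t1)));
  [rewrite Hinv; lra|].
rewrite <- !Rmult_assoc; apply Rmult_le_compat_r; lra.
Qed.

Ltac mpos := first [lra | apply Rmult_le_pos; mpos].

(** * Geometry of the sonic line *)

Definition zX (g X : R) : R := X * (1 - X) / (g * (1 - X) + 2 * X).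

Definition qG (m g X x : R) : R :=
  X + m * X ^ 2 + m * g * zX g X * (1 - X) - (X - 1 + m * g * zX g X) * x - x ^ 2.
Definition dG (m g X x : R) : R := (m + 1) * (1 - x) - 2 * m * zX g X.
Definition rF (m g X x : R) : R :=
  a1 m g * x ^ 2 + (a1 m g * X - a2 m g (zX g X)) * x + m * zX g X * X.

Lemma zX_den g X : 1 < g -> 0 < X < 1 -> 1 <= g * (1 - X) + 2 * X.
Proof. intros; nra. Qed.

(** This is v^2 + (1 + (2 - g) z) v + 2 z = 0, the quadratic with roots V_6 and V_8, taken at v = X
    - 1; it is linear in z, which is how [zX] arises. *)
Lemma zX_eq g X : 1 < g -> 0 < X < 1 -> zX g X * (g * (1 - X) + 2 * X) = X * (1 - X).
Proof. intros Hg HX; assert (H := zX_den g X Hg HX); unfold zX; field; lra. Qed.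

Lemma zX_pos g X : 1 < g -> 0 < X < 1 -> 0 < zX g X.
Proof.
intros Hg HX; assert (H := zX_den g X Hg HX).
unfold zX; apply Rdiv_lt_0_compat; nra.
Qed.

Lemma zX_lt_1 g X : 1 < g -> 0 < X < 1 -> zX g X < 1.
Proof.
intros Hg HX; assert (H := zX_den g X Hg HX); assert (E := zX_eq g X Hg HX).
assert (P := zX_pos g X Hg HX); nra.
Qed.

Lemma Gf_factor m g X V C : 1 < g -> 0 < X < 1 ->
  Gf m g (zX g X) V C =
  - ((X - (1 + V)) * qG m g X (1 + V) + (C ^ 2 - X ^ 2) * dG m g X (1 + V)).
Proof.
intros Hg HX; assert (H := zX_den g X Hg HX).
unfold Gf, qG, dG, lam, zX; field; lra.
Qed.

Lemma Ff_factor m g X V C : 1 < g -> 0 < X < 1 -> 1 + V <> 0 ->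
  (1 + V) * Ff m g (zX g X) V C =
  C * ((X - (1 + V)) * rF m g X (1 + V) + (C ^ 2 - X ^ 2) * (1 + V + m * zX g X)).
Proof.
intros Hg HX HV; assert (H := zX_den g X Hg HX).
unfold Ff, rF, a1, a2, a3, zX; field; lra.
Qed.

(** Dropping the nonnegative term with g in [zX_eq] gives 2 z <= 1 - X, so 2 m z uses up at most m
    of the m + 1 copies of 1 - X. *)
Lemma dG_lower m g X x : 1 < g -> 0 < X < 1 -> 1 <= m -> x <= X ->
  1 - X <= dG m g X x.
Proof.
intros Hg HX Hm Hx.
assert (H := zX_den g X Hg HX); assert (E := zX_eq g X Hg HX).
assert (P := zX_pos g X Hg HX).
unfold dG.
assert (0 <= g * (1 - X) * zX g X) by mpos.
assert (2 * zX g X <= 1 - X) by (apply Rmult_le_reg_l with X; lra).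
assert (m * (2 * zX g X) <= m * (1 - X)) by (apply Rmult_le_compat_l; lra).
assert ((m + 1) * (1 - X) <= (m + 1) * (1 - x)) by (apply Rmult_le_compat_l; lra).
lra.
Qed.

Lemma qG_lower m g X x : 1 < g -> 0 < X < 1 -> 1 <= m <= 2 -> 0 <= x <= X ->
  X * (1 - X) <= qG m g X x.
Proof.
intros Hg HX Hm Hx.
assert (H := zX_den g X Hg HX); assert (E := zX_eq g X Hg HX).
assert (P := zX_pos g X Hg HX).
unfold qG; set (z := zX g X) in *.
(* The right-hand side is [qG] at x = X. Its last term helps if 2 X <= 1; otherwise it is controlled
   by g z <= X, which [zX_eq] yields on dropping 2 X z. *)
assert (Hend : X * (1 - X) <= 2 * X - (2 - m) * X ^ 2 - m * g * z * (2 * X - 1)).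
{ assert (Hgz : g * z * (1 - X) = X * (1 - X) - 2 * X * z) by nra.
  assert (Hgz1 : g * z <= X) by nra.
  destruct (Rle_or_lt (2 * X) 1) as [H1|H1].
  - assert (m * g * z * (2 * X - 1) <= 0).
    { assert (0 <= m * g * z) by mpos. nra. }
    assert (0 <= (m - 1) * (X * X)) by mpos.
    lra.
  - assert (m * (g * z) * (2 * X - 1) <= m * X * (2 * X - 1)).
    { apply Rmult_le_compat_r; [lra|]; apply Rmult_le_compat_l; lra. }
    assert (0 <= (m + 1) * (X * (1 - X))) by mpos.
    lra. }
assert (H0 : X * (1 - X) <= X + m * X ^ 2 + m * g * z * (1 - X)).
{ assert (0 <= m * g * z * (1 - X)) by mpos. nra. }
(* [qG] is concave in [x], hence minimal at an end point of [0, X] *)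
set (q0 := X + m * X ^ 2 + m * g * z * (1 - X)) in *.
set (q1 := 2 * X - (2 - m) * X ^ 2 - m * g * z * (2 * X - 1)) in *.
assert (Hc : X * (q0 - (X - 1 + m * g * z) * x - x ^ 2)
   = (X - x) * q0 + x * q1 + X * x * (X - x)) by (unfold q0, q1; ring).
apply Rmult_le_reg_l with X; [lra|]; rewrite Hc.
assert ((X - x) * (X * (1 - X)) <= (X - x) * q0) by (apply Rmult_le_compat_l; lra).
assert (x * (X * (1 - X)) <= x * q1) by (apply Rmult_le_compat_l; lra).
assert (0 <= X * x * (X - x)) by mpos.
lra.
Qed.

Definition xL (g : R) : R := (g - 1) / (g + 1).

Lemma xL_eq g : 1 < g -> xL g * (g + 1) = g - 1.
Proof. intros; unfold xL; field; lra. Qed.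

Lemma xL_pos g : 1 < g -> 0 < xL g.
Proof. intros; unfold xL; apply Rdiv_lt_0_compat; lra. Qed.

(** It suffices that a_2 <= a_1 (x + X). For g <= 3 the z-term of a_2 is nonpositive, and since x +
    X >= 2 x_1 the rest reduces to 4 + m (g - 3) >= 0, which holds for g > 1 and m <= 2. *)
Lemma rF_lower m g X x : 1 < g <= 3 -> 0 < X < 1 -> 1 <= m <= 2 -> xL g <= x <= X ->
  m * zX g X * X <= rF m g X x.
Proof.
intros Hg HX Hm Hx.
assert (P := zX_pos g X (proj1 Hg) HX).
assert (E := xL_eq g (proj1 Hg)); assert (Pl := xL_pos g (proj1 Hg)).
assert (H : a2 m g (zX g X) <= a1 m g * (x + X)).
{ assert (Ha2 : a2 m g (zX g X) <= m * (g - 1) / 2).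
  { unfold a2; assert (m * zX g X * g * (g - 3) <= 0); [|lra].
    assert (0 <= m * zX g X * g) by mpos; nra. }
  assert (Hl : m * (g - 1) / 2 <= a1 m g * (2 * xL g)).
  { apply Rmult_le_reg_r with (g + 1); [lra|].
    replace (a1 m g * (2 * xL g) * (g + 1)) with (a1 m g * (2 * (g - 1)))
      by (rewrite <- E; ring).
    unfold a1; assert (0 <= m * (g - 1)) by mpos.
    assert (0 <= (g - 1) * (4 + m * (g - 3))) by (apply Rmult_le_pos; lra).
    nra. }
  assert (0 < a1 m g) by (unfold a1; nra).
  assert (a1 m g * (2 * xL g) <= a1 m g * (x + X)) by (apply Rmult_le_compat_l; lra).
  lra. }
unfold rF; assert (0 <= x * (a1 m g * (x + X) - a2 m g (zX g X))) by (apply Rmult_le_pos; lra).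
nra.
Qed.

(** The four terms are at most 3, 3, 9 and 2; the constant is a round number above their sum. *)
Lemma rF_upper m g X x : 1 < g <= 3 -> 0 < X < 1 -> 1 <= m <= 2 -> 0 <= x <= X ->
  rF m g X x <= 20.
Proof.
intros Hg HX Hm Hx.
assert (P := zX_pos g X (proj1 Hg) HX); assert (P1 := zX_lt_1 g X (proj1 Hg) HX).
unfold rF; set (z := zX g X) in *.
assert (Ha : 1 <= a1 m g <= 3) by (unfold a1; nra).
assert (Hmz : 0 <= m * z <= 2) by nra.
assert (Ha2 : - a2 m g z <= 9).
{ unfold a2; assert (0 <= g * (3 - g) <= 9) by nra.
  assert (m * z * (g * (3 - g)) <= 2 * 9) by (apply Rmult_le_compat; lra).
  assert (0 <= m * (g - 1)) by nra. nra. }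
assert (Hx2 : 0 <= x * x <= 1) by nra.
assert (HXx : 0 <= X * x <= 1) by nra.
assert (a1 m g * (x * x) <= 3 * 1) by (apply Rmult_le_compat; lra).
assert (a1 m g * (X * x) <= 3 * 1) by (apply Rmult_le_compat; lra).
assert (- a2 m g z * x <= 9 * x) by (apply Rmult_le_compat_r; lra).
assert (m * z * X <= 2 * 1) by (apply Rmult_le_compat; lra).
lra.
Qed.

(** At the sonic point [slopeA] is - G_C, [slopeB] is F_C - G_V and [rF m g X X] is - F_V. The slope
    equation becomes A c^2 + B c - r = 0 with A, r > 0, and [slope] is its single negative root. *)
Definition slopeA (m g X : R) : R := 2 * X * dG m g X X.
Definition slopeB (m g X : R) : R := 2 * X * (X + m * zX g X) - qG m g X X.
Definition slope (m g X : R) : R :=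
  - (slopeB m g X + sqrt (slopeB m g X ^ 2 + 4 * slopeA m g X * rF m g X X))
  / (2 * slopeA m g X).

(** Since A r > 0, the square root exceeds |B|, whence the sign of the slope. The last clause, B + 2
    A c = - sqrt (B^2 + 4 A r) <= 0, is the sign condition on [k1] at t = 0 in the Briot-Bouquet
    equation. *)
Lemma slope_spec m g X : 1 < g <= 3 -> 1 <= m <= 2 -> xL g <= X < 1 ->
  0 < dG m g X X /\ X * (1 - X) <= qG m g X X /\ 0 < rF m g X X /\
  slope m g X < 0 /\
  slopeA m g X * slope m g X ^ 2 + slopeB m g X * slope m g X - rF m g X X = 0 /\
  slopeB m g X + 2 * slopeA m g X * slope m g X <= 0.
Proof.
intros Hg Hm HX; assert (Pl := xL_pos g (proj1 Hg)).
assert (HX1 : 0 < X < 1) by lra.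
assert (Hd := dG_lower m g X X (proj1 Hg) HX1 (proj1 Hm) (Rle_refl X)).
assert (Hq := qG_lower m g X X (proj1 Hg) HX1 Hm ltac:(lra)).
assert (Hr := rF_lower m g X X Hg HX1 Hm ltac:(lra)).
assert (Hz := zX_pos g X (proj1 Hg) HX1).
assert (Hr0 : 0 < rF m g X X).
{ apply Rlt_le_trans with (2 := Hr).
  apply Rmult_lt_0_compat; [apply Rmult_lt_0_compat|]; lra. }
assert (HA : 0 < slopeA m g X).
{ unfold slopeA; apply Rmult_lt_0_compat; lra. }
set (A := slopeA m g X) in *; set (B := slopeB m g X) in *; set (R0 := rF m g X X) in *.
assert (HAR : 0 < A * R0) by now apply Rmult_lt_0_compat.
set (S := sqrt (B ^ 2 + 4 * A * R0)).
assert (HS2 : S * S = B ^ 2 + 4 * A * R0) by (apply sqrt_sqrt; generalize (pow2_ge_0 B); lra).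
assert (HS : 0 <= S) by apply sqrt_pos.
assert (HSB : 0 < B + S) by nra.
assert (E : 2 * A * slope m g X = - (B + S)).
{ unfold slope; fold A B R0 S; field; lra. }
set (c := slope m g X) in *.
repeat split; try lra.
- apply Rmult_lt_reg_l with (2 * A); lra.
- apply Rmult_eq_reg_l with (4 * A); [|lra].
  replace (4 * A * (A * c ^ 2 + B * c - R0)) with
    ((2 * A * c) ^ 2 + 2 * B * (2 * A * c) - 4 * A * R0) by ring.
  rewrite E; nra.
Qed.

Ltac cont :=
  match goal with
  | |- continuous (fun x => x) _ => apply continuous_id
  | |- continuous (fun x => @?f x + @?h x) _ => apply (continuous_Rplus f h); cont
  | |- continuous (fun x => @?f x - @?h x) _ => apply (continuous_Rminus f h); cont
  | |- continuous (fun x => @?f x * @?h x) _ => apply (continuous_Rmult f h); cont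
  | |- continuous (fun x => @?f x / @?h x) _ =>
      apply (continuous_Rmult f (fun x => / h x)); cont
  | |- continuous (fun x => / @?f x) _ => apply (continuous_Rinv_comp f); [cont|]
  | |- continuous (fun x => - @?f x) _ => apply (continuous_opp f); cont
  | |- continuous (fun x => sqrt (@?f x)) _ => apply (continuous_sqrt_comp f); cont
  | |- continuous (fun x => @?f x ^ 2) _ =>
      apply (continuous_Rmult f (fun x => f x * 1)); cont
  | |- continuous (fun x => ?c) _ => apply continuous_const
  | _ => try assumption
  end.

Lemma continuous_zX g X : 1 < g -> 0 < X < 1 -> continuous (fun Y => zX g Y) X.
Proof.
intros Hg HX; assert (H := zX_den g X Hg HX).
unfold zX; cont; lra.
Qed.

Lemma continuous_slope m g X : 1 < g <= 3 -> 1 <= m <= 2 -> xL g <= X < 1 ->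
  continuous (fun Y => slope m g Y) X.
Proof.
intros Hg Hm HX.
destruct (slope_spec m g X Hg Hm HX) as [Hd _].
assert (Pl := xL_pos g (proj1 Hg)).
assert (Hz := continuous_zX g X (proj1 Hg) ltac:(lra)).
assert (HA : 0 < slopeA m g X).
{ unfold slopeA; apply Rmult_lt_0_compat; lra. }
assert (CA : continuous (fun Y => slopeA m g Y) X).
{ unfold slopeA, dG; cont. }
assert (CB : continuous (fun Y => slopeB m g Y) X).
{ unfold slopeB, qG; cont. }
assert (CR : continuous (fun Y => rF m g Y Y) X).
{ unfold rF, a1, a2; cont; lra. }
unfold slope; cont; lra.
Qed.

(** * The local analytic solution at the sonic point *)

Ltac analytic :=
  match goal with
  | |- analytic_family _ _ (fun X t => t) => apply analytic_var
  | |- analytic_family _ _ (fun X t => ?f) =>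
     apply (analytic_const _ _ (fun _ => f)); intros; apply continuous_const
  | |- analytic_family _ _ (fun X t => X) =>
     apply (analytic_const _ _ (fun X => X)); intros; apply continuous_id
  | |- analytic_family _ _ (fun X t => @?F X t + @?H X t) =>
     apply (analytic_plus _ _ F H); analytic
  | |- analytic_family _ _ (fun X t => @?F X t - @?H X t) =>
     apply (analytic_minus _ _ F H); analytic
  | |- analytic_family _ _ (fun X t => @?F X t * @?H X t) =>
     apply (analytic_mult _ _ F H); analytic
  | |- analytic_family _ _ (fun X t => @?F X t / ?c) =>
     apply (analytic_mult _ _ F (fun _ _ => / c)); analytic
  | |- analytic_family _ _ (fun X t => - @?F X t) =>
     apply (analytic_opp _ _ F); analytic
  | |- analytic_family _ _ (fun X t => @?F X t ^ ?n) =>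
     apply (analytic_pow _ _ F n); analytic
  | _ => try assumption
  end.

Definition loc_y (m g X : R) (w : nat -> R) (t : R) : R :=
  X + t * (slope m g X + PSeries w t).

Definition loc_dy (m g X : R) (w : nat -> R) (t : R) : R :=
  slope m g X + PSeries w t + t * PSeries (PS_derive w) t.

Theorem local_solution_family m g a b A0 :
  1 < g <= 3 -> 1 <= m <= 2 -> xL g <= a -> a <= b -> b < 1 -> 0 < A0 ->
  exists r W, 0 < r <= 1 /\
    (forall n X, a <= X <= b -> continuous (fun Y => W Y n) X) /\
    (forall X, W X 0%nat = 0) /\
    (forall X, a <= X <= b -> forall N, wnorm r (W X) N <= A0) /\
    (forall X t, a <= X <= b -> Rabs t < r -> 0 < X + t ->
       Gf m g (zX g X) (X + t - 1) (loc_y m g X (W X) t) * loc_dy m g X (W X) t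
       = Ff m g (zX g X) (X + t - 1) (loc_y m g X (W X) t)).
Proof.
intros Hg Hm Ha Hab Hb HA0.
assert (Pl := xL_pos g (proj1 Hg)).
assert (Az : analytic_family a b (fun X _ => zX g X)).
{ apply analytic_const; intros X HX; apply continuous_zX; lra. }
assert (Ac : analytic_family a b (fun X _ => slope m g X)).
{ apply analytic_const; intros X HX; apply continuous_slope; lra. }
assert (Aq : analytic_family a b (fun X t => qG m g X (X + t))) by (unfold qG; analytic).
assert (Ad : analytic_family a b (fun X t => dG m g X (X + t))) by (unfold dG; analytic).
assert (Ar : analytic_family a b (fun X t => rF m g X (X + t)))
  by (unfold rF, a1, a2; analytic).
pose (x := fun X t : R => X + t).
pose (E := fun X t => X + t + m * zX g X).
(* With C = X + t (c + w), the quotient (C^2 - X^2) / t equals M0 + M1 w + M2 w^2. Hence x G / t =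
   g0 + g1 w + g2 w^2, and the k's collect x F / t - (c + w) x G / t by powers of w. *)
pose (M0 := fun X t => 2 * X * slope m g X + t * slope m g X ^ 2).
pose (M1 := fun X t => 2 * X + 2 * t * slope m g X).
pose (M2 := fun X t : R => t).
pose (Y := fun X t => X + t * slope m g X).
pose (N0 := fun X t => M0 X t * E X t - rF m g X (X + t)).
pose (g0 := fun X t => x X t * (qG m g X (X + t) - dG m g X (X + t) * M0 X t)).
pose (g1 := fun X t => - (x X t * dG m g X (X + t) * M1 X t)).
pose (g2 := fun X t => - (x X t * dG m g X (X + t) * M2 X t)).
pose (k0 := fun X t => Y X t * N0 X t - slope m g X * g0 X t).
pose (k1 := fun X t => Y X t * (M1 X t * E X t) + t * N0 X t - g0 X t - slope m g X * g1 X t).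
pose (k2 := fun X t => Y X t * (M2 X t * E X t) + t * (M1 X t * E X t)
                      - g1 X t - slope m g X * g2 X t).
pose (k3 := fun X t => t * (M2 X t * E X t) - g2 X t).
assert (AM0 : analytic_family a b M0) by (unfold M0; analytic).
assert (AM1 : analytic_family a b M1) by (unfold M1; analytic).
assert (AM2 : analytic_family a b M2) by (unfold M2; analytic).
assert (AE : analytic_family a b E) by (unfold E; analytic).
assert (AY : analytic_family a b Y) by (unfold Y; analytic).
assert (Ax : analytic_family a b x) by (unfold x; analytic).
assert (AN0 : analytic_family a b N0) by (unfold N0; analytic).
assert (Ag0 : analytic_family a b g0) by (unfold g0; analytic).
assert (Ag1 : analytic_family a b g1) by (unfold g1; analytic).
assert (Ag2 : analytic_family a b g2) by (unfold g2; analytic).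
assert (Ak0 : analytic_family a b k0) by (unfold k0; analytic).
assert (Ak1 : analytic_family a b k1) by (unfold k1; analytic).
assert (Ak2 : analytic_family a b k2) by (unfold k2; analytic).
assert (Ak3 : analytic_family a b k3) by (unfold k3; analytic).
(* The lower bound for [g0] at t = 0: g0 = X (q - 2 X d c) >= X q >= X^2 (1 - X), as d > 0 > c. *)
destruct (briot_bouquet_family a b k0 k1 k2 k3 g0 g1 g2 (a * (a * (1 - b))) A0)
  as [r [W [Hr [HC [H0 [HN HE]]]]]]; auto.
{ repeat apply Rmult_lt_0_compat; lra. }
{ intros X HX.
  destruct (slope_spec m g X Hg Hm ltac:(lra)) as [Hd [Hq [HR [Hc [HQ HS]]]]].
  unfold k0, k1, g0, g1, N0, Y, M0, M1, E, x; rewrite !Rplus_0_r.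
  unfold slopeA, slopeB in HQ, HS.
  set (c := slope m g X) in *; set (D := dG m g X X) in *; set (q := qG m g X X) in *.
  (* At t = 0 the forcing vanishes by the slope equation, and [k1] is X (B + 2 A c). *)
  repeat split.
  - replace (_ - _) with
      (X * (2 * X * D * c ^ 2 + (2 * X * (X + m * zX g X) - q) * c - rF m g X X)) by ring.
    rewrite HQ; ring.
  - replace (_ - _) with
      (X * (2 * X * (X + m * zX g X) - q + 2 * (2 * X * D) * c)) by ring.
    assert (0 < X) by lra; nra.
  - apply Rmult_le_compat; try lra; [apply Rmult_le_pos; lra|].
    assert (a * (1 - b) <= X * (1 - X)) by (apply Rmult_le_compat; lra).
    assert (0 <= D * (X * - c)) by (repeat apply Rmult_le_pos; lra).
    nra. }
exists r, W; split; [exact Hr|split; [exact HC|split; [exact H0|split; [exact HN|]]]].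
intros X t HX Ht Hxt.
specialize (HE X t HX Ht); cbv zeta in HE.
assert (HX1 : 0 < X < 1) by lra.
rewrite (Gf_factor m g X _ _ (proj1 Hg) HX1).
assert (Hxn : 1 + (X + t - 1) <> 0) by (apply Rgt_not_eq; lra).
apply Rmult_eq_reg_l with (1 + (X + t - 1)); [|exact Hxn].
rewrite (Ff_factor m g X _ _ (proj1 Hg) HX1 Hxn).
replace (1 + (X + t - 1)) with (X + t) by ring.
unfold loc_y, loc_dy.
unfold k0, k1, k2, k3, g0, g1, g2, N0, Y, M0, M1, M2, E, x in HE.
set (w := PSeries (W X) t) in *; set (dw := PSeries (PS_derive (W X)) t) in *.
set (c := slope m g X) in *; set (D := dG m g X (X + t)) in *;
set (q := qG m g X (X + t)) in *; set (R := rF m g X (X + t)) in *.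
set (z := zX g X) in *; clearbody w dw c D q R z.
(* The Briot-Bouquet equation is the ODE times x with a common factor t removed; this restores the
   factor. *)
apply (f_equal (fun u => t * u)) in HE.
apply Rminus_diag_eq in HE; apply Rminus_diag_uniq; rewrite <- HE; ring.
Qed.

(** * Bounded Lipschitz functions *)

Definition bounded_lipschitz {T : Type} (S : T -> Prop) (d : T -> T -> R) (f : T -> R) :=
  exists B L, 0 <= B /\ 0 <= L /\ (forall u, S u -> Rabs (f u) <= B) /\
    (forall u v, S u -> S v -> Rabs (f u - f v) <= L * d u v).

Lemma bl_const {T} (S : T -> Prop) d c : (forall u v, 0 <= d u v) ->
  bounded_lipschitz S d (fun _ => c).
Proof.
intros Hd; exists (Rabs c), 0; split; [apply Rabs_pos|split; [lra|split; [intros; lra|]]].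
intros; rewrite Rminus_diag, Rabs_R0; lra.
Qed.

Lemma bl_plus {T} (S : T -> Prop) d f h : (forall u v, 0 <= d u v) ->
  bounded_lipschitz S d f -> bounded_lipschitz S d h ->
  bounded_lipschitz S d (fun u => f u + h u).
Proof.
intros Hd [B1 [L1 [HB1 [HL1 [H1 K1]]]]] [B2 [L2 [HB2 [HL2 [H2 K2]]]]].
exists (B1 + B2), (L1 + L2); split; [lra|split; [lra|split]].
- intros u Hu; apply Rle_trans with (1 := Rabs_triang _ _).
  specialize (H1 u Hu); specialize (H2 u Hu); lra.
- intros u v Hu Hv; replace (f u + h u - (f v + h v)) with ((f u - f v) + (h u - h v)) by ring.
  apply Rle_trans with (1 := Rabs_triang _ _).
  specialize (K1 u v Hu Hv); specialize (K2 u v Hu Hv); lra.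
Qed.

Lemma bl_opp {T} (S : T -> Prop) d f :
  bounded_lipschitz S d f -> bounded_lipschitz S d (fun u => - f u).
Proof.
intros [B1 [L1 [HB1 [HL1 [H1 K1]]]]]; exists B1, L1; split; [lra|split; [lra|split]].
- intros u Hu; rewrite Rabs_Ropp; auto.
- intros u v Hu Hv; replace (- f u - - f v) with (- (f u - f v)) by ring.
  rewrite Rabs_Ropp; auto.
Qed.

Lemma bl_mult {T} (S : T -> Prop) d f h : (forall u v, 0 <= d u v) ->
  bounded_lipschitz S d f -> bounded_lipschitz S d h ->
  bounded_lipschitz S d (fun u => f u * h u).
Proof.
intros Hd [B1 [L1 [HB1 [HL1 [H1 K1]]]]] [B2 [L2 [HB2 [HL2 [H2 K2]]]]].
exists (B1 * B2), (B1 * L2 + B2 * L1); split; [nra|split; [nra|split]].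
- intros u Hu; rewrite Rabs_mult; apply Rmult_le_compat; auto; apply Rabs_pos.
- intros u v Hu Hv.
  replace (f u * h u - f v * h v) with (f u * (h u - h v) + h v * (f u - f v)) by ring.
  apply Rle_trans with (1 := Rabs_triang _ _); rewrite !Rabs_mult.
  replace ((B1 * L2 + B2 * L1) * d u v) with (B1 * (L2 * d u v) + B2 * (L1 * d u v)) by ring.
  apply Rplus_le_compat; apply Rmult_le_compat; auto; apply Rabs_pos.
Qed.

Lemma bl_inv {T} (S : T -> Prop) d f k : (forall u v, 0 <= d u v) ->
  0 < k -> (forall u, S u -> k <= f u) ->
  bounded_lipschitz S d f -> bounded_lipschitz S d (fun u => / f u).
Proof.
intros Hd Hk Hf [B1 [L1 [HB1 [HL1 [H1 K1]]]]].
assert (Hki : 0 < / k) by now apply Rinv_0_lt_compat.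
assert (Hb : forall u, S u -> 0 < / f u <= / k).
{ intros u Hu; specialize (Hf u Hu); split; [apply Rinv_0_lt_compat; lra|].
  apply Rinv_le_contravar; lra. }
exists (/ k), (/ k * / k * L1); split; [lra|split; [|split]].
- repeat apply Rmult_le_pos; lra.
- intros u Hu; specialize (Hb u Hu); rewrite Rabs_pos_eq; lra.
- intros u v Hu Hv.
  assert (Fu := Hf u Hu); assert (Fv := Hf v Hv).
  replace (/ f u - / f v) with (/ f u * / f v * (f v - f u)) by (field; lra).
  rewrite !Rabs_mult, (Rmult_assoc _ L1).
  assert (Bu := Hb u Hu); assert (Bv := Hb v Hv).
  rewrite (Rabs_pos_eq (/ f u)), (Rabs_pos_eq (/ f v)) by lra.
  apply Rmult_le_compat.
  + apply Rmult_le_pos; lra.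
  + apply Rabs_pos.
  + apply Rmult_le_compat; lra.
  + rewrite Rabs_minus_sym; now apply K1.
Qed.

Lemma bl_max {T} (S : T -> Prop) d f c :
  bounded_lipschitz S d f -> bounded_lipschitz S d (fun u => Rmax (f u) c).
Proof.
intros [B1 [L1 [HB1 [HL1 [H1 K1]]]]].
exists (B1 + Rabs c), L1; split; [generalize (Rabs_pos c); lra|split; [lra|split]].
- intros u Hu; specialize (H1 u Hu); assert (Hc := Rabs_pos c).
  unfold Rmax; destruct (Rle_dec (f u) c); [generalize (Rabs_pos (f u)); lra|lra].
- intros u v Hu Hv; apply Rle_trans with (1 := Rmax_lipschitz c _ _); auto.
Qed.

(** * The flow away from the sonic point *)

Definition xclamp (g X t : R) : R := Rmax (X - t) (xL g).
(** Since p = X^2 / C^2, multiplying the brackets in the factorizations of x F and G by p replaces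
    C^2 - X^2 by X^2 (1 - p). The results are affine in p on [0, 1], and large C corresponds to p
    near 0. *)
Definition numR (m g X t p : R) : R :=
  t * p * rF m g X (xclamp g X t) + X * X * (1 - p) * (xclamp g X t + m * zX g X).
Definition denR (m g X t p : R) : R :=
  t * p * qG m g X (xclamp g X t) + X * X * (1 - p) * dG m g X (xclamp g X t).

(* With [l = ln (C / X)], [t = X - x] and [p = exp (- 2 l)], the equation [C' = F / G]
   reads [dl/dt = hR]. *)
Definition hR (m g X t p : R) : R := / xclamp g X t * (numR m g X t p * / denR m g X t p).

(** A common lower bound for [qG] and [dG] when x_1 <= X <= b; [slopeK] is the resulting bound on
    dl/dt. *)
Definition kapR (g b : R) : R := xL g * (1 - b).
Definition slopeK (g b : R) : R := / xL g * (20 / kapR g b).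

Lemma kapR_pos g b : 1 < g -> b < 1 -> 0 < kapR g b.
Proof. intros Hg Hb; apply Rmult_lt_0_compat; [now apply xL_pos|lra]. Qed.

Lemma xclamp_bounds g X t : xL g <= X -> 0 <= t -> xL g <= xclamp g X t <= X.
Proof. intros HX Ht; unfold xclamp, Rmax; destruct Rle_dec; lra. Qed.

(** Numerator and denominator are compared with the same weight t p + X^2 (1 - p), which cancels in
    the quotient. The weight tends to 0 at the sonic point, yet the growth bound obtained this way
    is independent of the distance to it. *)
Lemma hR_num_den m g b X t p : 1 < g <= 3 -> 1 <= m <= 2 -> b < 1 ->
  xL g <= X <= b -> 0 <= t -> 0 <= p <= 1 ->
  0 <= numR m g X t p /\ kapR g b * (t * p + X * X * (1 - p)) <= denR m g X t p /\
  numR m g X t p <= 20 * (t * p + X * X * (1 - p)).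
Proof.
intros Hg Hm Hb HX Ht Hp.
assert (Pl := xL_pos g (proj1 Hg)).
assert (HX1 : 0 < X < 1) by lra.
assert (Hx := xclamp_bounds g X t (proj1 HX) Ht).
assert (Pz := zX_pos g X (proj1 Hg) HX1); assert (Pz1 := zX_lt_1 g X (proj1 Hg) HX1).
assert (Hr := rF_lower m g X _ Hg HX1 Hm Hx).
assert (Hr2 := rF_upper m g X (xclamp g X t) Hg HX1 Hm ltac:(lra)).
assert (Hq := qG_lower m g X (xclamp g X t) (proj1 Hg) HX1 Hm ltac:(lra)).
assert (Hd := dG_lower m g X (xclamp g X t) (proj1 Hg) HX1 (proj1 Hm) (proj2 Hx)).
assert (Hk : kapR g b <= X * (1 - X)) by (apply Rmult_le_compat; lra).
assert (Hk2 : kapR g b <= 1 - X) by (unfold kapR; nra).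
assert (Htp : 0 <= t * p) by (apply Rmult_le_pos; lra).
assert (HXp : 0 <= X * X * (1 - p)) by (apply Rmult_le_pos; nra).
assert (Hmz : 0 <= m * zX g X <= 2) by nra.
assert (Hmzx : 0 <= m * zX g X * X) by (apply Rmult_le_pos; lra).
unfold numR, denR; set (x := xclamp g X t) in *.
set (tp := t * p) in *; set (Xp := X * X * (1 - p)) in *.
repeat split.
- apply Rplus_le_le_0_compat; apply Rmult_le_pos; lra.
- assert (tp * kapR g b <= tp * qG m g X x) by (apply Rmult_le_compat_l; lra).
  assert (Xp * kapR g b <= Xp * dG m g X x) by (apply Rmult_le_compat_l; lra).
  lra.
- assert (tp * rF m g X x <= tp * 20) by (apply Rmult_le_compat_l; lra).
  assert (Xp * (x + m * zX g X) <= Xp * 20) by (apply Rmult_le_compat_l; lra).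
  lra.
Qed.

Lemma hR_bounds m g b X t p : 1 < g <= 3 -> 1 <= m <= 2 -> b < 1 ->
  xL g <= X <= b -> 0 < t -> 0 <= p <= 1 ->
  0 < denR m g X t p /\ 0 <= hR m g X t p <= slopeK g b.
Proof.
intros Hg Hm Hb HX Ht Hp.
assert (Pl := xL_pos g (proj1 Hg)); assert (Pk := kapR_pos g b (proj1 Hg) Hb).
destruct (hR_num_den m g b X t p Hg Hm Hb HX ltac:(lra) Hp) as [N0 [D0 N1]].
assert (Hx := xclamp_bounds g X t (proj1 HX) ltac:(lra)).
set (s := t * p + X * X * (1 - p)) in *.
assert (Hs : 0 < s).
{ assert (0 < X * X) by nra.
  destruct (Req_dec p 0) as [->|Hp0]; [unfold s; lra|].
  assert (0 < t * p) by (apply Rmult_lt_0_compat; lra).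
  assert (0 <= X * X * (1 - p)) by (apply Rmult_le_pos; lra).
  unfold s; lra. }
assert (Hks : 0 < kapR g b * s) by now apply Rmult_lt_0_compat.
assert (Hden : 0 < denR m g X t p) by lra.
split; [exact Hden|].
assert (Hq : 0 <= numR m g X t p * / denR m g X t p <= 20 / kapR g b).
{ split; [apply Rmult_le_pos; [exact N0|left; now apply Rinv_0_lt_compat]|].
  apply Rmult_le_reg_r with (denR m g X t p); [exact Hden|].
  rewrite Rmult_assoc, Rinv_l, Rmult_1_r by lra.
  apply Rle_trans with (1 := N1).
  apply Rle_trans with (20 / kapR g b * (kapR g b * s)); [right; field; lra|].
  apply Rmult_le_compat_l; [|exact D0].
  apply Rmult_le_pos; [lra|left; now apply Rinv_0_lt_compat]. }
assert (Hi : 0 < / xclamp g X t <= / xL g).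
{ split; [apply Rinv_0_lt_compat; lra|apply Rinv_le_contravar; lra]. }
unfold hR, slopeK; split; [apply Rmult_le_pos; lra|].
apply Rmult_le_compat; lra.
Qed.

Definition dist3 (u v : R * R * R) : R :=
  Rabs (fst (fst u) - fst (fst v)) + Rabs (snd (fst u) - snd (fst v))
  + Rabs (snd u - snd v).

Definition dom3 (g b e : R) (u : R * R * R) : Prop :=
  xL g <= fst (fst u) <= b /\ e <= snd (fst u) <= 1 /\ 0 <= snd u <= 1.

Lemma dist3_pos u v : 0 <= dist3 u v.
Proof.
unfold dist3.
generalize (Rabs_pos (fst (fst u) - fst (fst v))) (Rabs_pos (snd (fst u) - snd (fst v)))
  (Rabs_pos (snd u - snd v)); lra.
Qed.

Ltac bl :=
  match goal with
  | |- bounded_lipschitz _ _ (fun u => ?c) => apply bl_const, dist3_pos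
  | |- bounded_lipschitz _ _ (fun u => @?f u + @?h u) =>
      apply (bl_plus _ _ f h dist3_pos); bl
  | |- bounded_lipschitz _ _ (fun u => @?f u - @?h u) =>
      apply (bl_plus _ _ f (fun u => - h u) dist3_pos); bl
  | |- bounded_lipschitz _ _ (fun u => @?f u * @?h u) =>
      apply (bl_mult _ _ f h dist3_pos); bl
  | |- bounded_lipschitz _ _ (fun u => @?f u / ?c) =>
      apply (bl_mult _ _ f (fun u => / c) dist3_pos); bl
  | |- bounded_lipschitz _ _ (fun u => @?f u ^ 2) =>
      apply (bl_mult _ _ f (fun u => f u * 1) dist3_pos); bl
  | |- bounded_lipschitz _ _ (fun u => - @?f u) => apply (bl_opp _ _ f); bl
  | |- bounded_lipschitz _ _ (fun u => Rmax (@?f u) ?c) => apply (bl_max _ _ f c); bl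
  | _ => try assumption
  end.

Lemma hR_lipschitz m g b e : 1 < g <= 3 -> 1 <= m <= 2 -> b < 1 -> 0 < e ->
  bounded_lipschitz (dom3 g b e) dist3
    (fun u => hR m g (fst (fst u)) (snd (fst u)) (snd u)).
Proof.
intros Hg Hm Hb He.
assert (Pl := xL_pos g (proj1 Hg)); assert (Pk := kapR_pos g b (proj1 Hg) Hb).
set (S := dom3 g b e).
assert (B1 : bounded_lipschitz S dist3 (fun u => fst (fst u))).
{ exists 1, 1; split; [lra|split; [lra|split]].
  - intros u [Hu _]; rewrite Rabs_pos_eq; lra.
  - intros u v _ _; unfold dist3.
    generalize (Rabs_pos (snd (fst u) - snd (fst v))) (Rabs_pos (snd u - snd v)); lra. }
assert (B2 : bounded_lipschitz S dist3 (fun u => snd (fst u))).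
{ exists 1, 1; split; [lra|split; [lra|split]].
  - intros u [_ [Hu _]]; rewrite Rabs_pos_eq; lra.
  - intros u v _ _; unfold dist3.
    generalize (Rabs_pos (fst (fst u) - fst (fst v))) (Rabs_pos (snd u - snd v)); lra. }
assert (B3 : bounded_lipschitz S dist3 (fun u => snd u)).
{ exists 1, 1; split; [lra|split; [lra|split]].
  - intros u [_ [_ Hu]]; rewrite Rabs_pos_eq; lra.
  - intros u v _ _; unfold dist3.
    generalize (Rabs_pos (fst (fst u) - fst (fst v)))
      (Rabs_pos (snd (fst u) - snd (fst v))); lra. }
assert (Bz : bounded_lipschitz S dist3 (fun u => zX g (fst (fst u)))).
{ unfold zX.
  apply (bl_mult _ _ (fun u => fst (fst u) * (1 - fst (fst u)))
    (fun u => / (g * (1 - fst (fst u)) + 2 * fst (fst u))) dist3_pos); [bl|].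
  apply bl_inv with 1; [apply dist3_pos|lra| |bl].
  intros u [Hu _]; apply zX_den; lra. }
assert (Bx : bounded_lipschitz S dist3 (fun u => xclamp g (fst (fst u)) (snd (fst u))))
  by (unfold xclamp; bl).
assert (Br : bounded_lipschitz S dist3 (fun u =>
  rF m g (fst (fst u)) (xclamp g (fst (fst u)) (snd (fst u)))))
  by (unfold rF, a1, a2; bl).
assert (Bq : bounded_lipschitz S dist3 (fun u =>
  qG m g (fst (fst u)) (xclamp g (fst (fst u)) (snd (fst u))))) by (unfold qG; bl).
assert (Bd : bounded_lipschitz S dist3 (fun u =>
  dG m g (fst (fst u)) (xclamp g (fst (fst u)) (snd (fst u))))) by (unfold dG; bl).
assert (Bn : bounded_lipschitz S dist3 (fun u =>
  numR m g (fst (fst u)) (snd (fst u)) (snd u))) by (unfold numR; bl).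
assert (Bde : bounded_lipschitz S dist3 (fun u =>
  denR m g (fst (fst u)) (snd (fst u)) (snd u))) by (unfold denR; bl).
unfold hR.
apply (bl_mult _ _ (fun u => / xclamp g (fst (fst u)) (snd (fst u)))
  (fun u => numR m g (fst (fst u)) (snd (fst u)) (snd u)
    * / denR m g (fst (fst u)) (snd (fst u)) (snd u)) dist3_pos).
- apply bl_inv with (xL g); [apply dist3_pos|lra| |exact Bx].
  intros u [Hu [Hu2 _]]; apply xclamp_bounds; lra.
- apply bl_mult; [apply dist3_pos|exact Bn|].
  (* The weight t p + X^2 (1 - p) is a convex combination of t >= e and X^2 >= x_1^2. Unlike the
     growth bound, the Lipschitz constant does use e. *)
  set (mu := Rmin e (xL g * xL g)).
  assert (Hmu : 0 < mu) by (apply Rmin_glb_lt; nra).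
  apply bl_inv with (kapR g b * mu); [apply dist3_pos| | |exact Bde].
  + now apply Rmult_lt_0_compat.
  + intros [[X t] p] [HX [Ht Hp]]; simpl in *.
    destruct (hR_num_den m g b X t p Hg Hm Hb HX ltac:(lra) Hp) as [_ [D0 _]].
    apply Rle_trans with (2 := D0), Rmult_le_compat_l; [lra|].
    assert (mu <= e) by apply Rmin_l; assert (mu <= xL g * xL g) by apply Rmin_r.
    assert (xL g * xL g <= X * X) by nra.
    assert (mu * p <= t * p) by (apply Rmult_le_compat_r; lra).
    assert (mu * (1 - p) <= X * X * (1 - p)) by (apply Rmult_le_compat_r; lra).
    lra.
Qed.

(** The clamps extend the equation to all t and l. They are inactive for e <= t <= X - x_1 and l >=
    0, and the flow stays in l >= 0 because it starts there and does not decrease. *)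
Definition tclamp (e t : R) : R := Rmax (Rmin t 1) e.
Definition pl (l : R) : R := exp (- 2 * Rmax l 0).
Definition flowH (m g e X t l : R) : R := hR m g X (tclamp e t) (pl l).

Lemma tclamp_bounds e t : e <= 1 -> e <= tclamp e t <= 1.
Proof. intros He; unfold tclamp, Rmax, Rmin; repeat destruct Rle_dec; lra. Qed.

Lemma tclamp_id e t : e <= t <= 1 -> tclamp e t = t.
Proof. intros He; unfold tclamp, Rmax, Rmin; repeat destruct Rle_dec; lra. Qed.

Lemma tclamp_lipschitz e t t' : Rabs (tclamp e t - tclamp e t') <= Rabs (t - t').
Proof.
apply Rle_trans with (1 := Rmax_lipschitz e _ _).
unfold Rmin; repeat destruct Rle_dec; unfold Rabs; repeat destruct Rcase_abs; lra.
Qed.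

Lemma pl_bounds l : 0 <= pl l <= 1.
Proof.
unfold pl; split; [left; apply exp_pos|].
rewrite <- exp_0; assert (H := Rmax_r l 0).
destruct (Req_dec (Rmax l 0) 0) as [->|Hn]; [rewrite Rmult_0_r; lra|].
left; apply exp_increasing; lra.
Qed.

Lemma exp_neg_lipschitz a b : 0 <= a -> 0 <= b ->
  Rabs (exp (- 2 * a) - exp (- 2 * b)) <= 2 * Rabs (a - b).
Proof.
assert (Hgen : forall a b, 0 <= a <= b ->
   0 <= exp (- 2 * a) - exp (- 2 * b) <= 2 * (b - a)).
{ intros u v [Hu Huv].
  replace (exp (- 2 * v)) with (exp (- 2 * u) * exp (- 2 * (v - u)))
    by (rewrite <- exp_plus; f_equal; ring).
  assert (H1 := exp_ineq1_le (- 2 * (v - u))).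
  assert (H2 : exp (- 2 * u) <= 1).
  { rewrite <- exp_0; destruct (Req_dec u 0) as [->|]; [rewrite Rmult_0_r; lra|].
    left; apply exp_increasing; lra. }
  assert (H3 : exp (- 2 * (v - u)) <= 1).
  { rewrite <- exp_0; destruct (Req_dec u v) as [->|]; [rewrite Rminus_diag, Rmult_0_r; lra|].
    left; apply exp_increasing; lra. }
  assert (H4 := exp_pos (- 2 * u)).
  set (E := exp (- 2 * u)) in *; set (E' := exp (- 2 * (v - u))) in *.
  split; nra. }
intros Ha Hb; destruct (Rle_or_lt a b) as [H|H].
- destruct (Hgen a b ltac:(lra)); rewrite Rabs_pos_eq by lra.
  rewrite Rabs_left1; lra.
- destruct (Hgen b a ltac:(lra)).
  rewrite Rabs_left1 by lra; rewrite Rabs_pos_eq; lra.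
Qed.

Lemma pl_lipschitz l l' : Rabs (pl l - pl l') <= 2 * Rabs (l - l').
Proof.
apply Rle_trans with (1 := exp_neg_lipschitz _ _ (Rmax_r l 0) (Rmax_r l' 0)).
apply Rmult_le_compat_l; [lra|apply Rmax_lipschitz].
Qed.

Lemma flowH_lipschitz m g b e : 1 < g <= 3 -> 1 <= m <= 2 -> b < 1 -> 0 < e <= 1 ->
  exists L, 0 < L /\ forall X X' t t' l l', xL g <= X <= b -> xL g <= X' <= b ->
    Rabs (flowH m g e X t l - flowH m g e X' t' l')
    <= L * (Rabs (X - X') + Rabs (t - t') + Rabs (l - l')).
Proof.
intros Hg Hm Hb He.
destruct (hR_lipschitz m g b e Hg Hm Hb (proj1 He)) as [B [L [_ [HL [_ HK]]]]].
exists (2 * L + 1); split; [lra|]; intros X X' t t' l l' HX HX'.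
assert (H := HK (X, tclamp e t, pl l) (X', tclamp e t', pl l')).
unfold dom3, dist3 in H; simpl in H.
assert (H1 := H (conj HX (conj (tclamp_bounds e t (proj2 He)) (pl_bounds l)))
  (conj HX' (conj (tclamp_bounds e t' (proj2 He)) (pl_bounds l')))).
unfold flowH; apply Rle_trans with (1 := H1).
assert (T := tclamp_lipschitz e t t'); assert (P := pl_lipschitz l l').
assert (Rabs (X - X') >= 0) by (apply Rle_ge, Rabs_pos).
assert (Rabs (t - t') >= 0) by (apply Rle_ge, Rabs_pos).
assert (Rabs (l - l') >= 0) by (apply Rle_ge, Rabs_pos).
apply Rle_trans with (L * (2 * (Rabs (X - X') + Rabs (t - t') + Rabs (l - l')))).
- apply Rmult_le_compat_l; lra.
- nra.
Qed.

Lemma flowH_bounds m g b e X t l : 1 < g <= 3 -> 1 <= m <= 2 -> b < 1 -> 0 < e <= 1 ->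
  xL g <= X <= b -> 0 <= flowH m g e X t l <= slopeK g b.
Proof.
intros Hg Hm Hb He HX; unfold flowH.
assert (T := tclamp_bounds e t (proj2 He)).
apply hR_bounds; auto; [lra|apply pl_bounds].
Qed.

Definition is_flow (m g e X l0 : R) (y : R -> R) : Prop :=
  y e = l0 /\ forall t, e <= t -> is_derive y t (flowH m g e X t (y t)).

Lemma flow_exists m g b e X l0 : 1 < g <= 3 -> 1 <= m <= 2 -> b < 1 -> 0 < e <= 1 ->
  xL g <= X <= b -> exists y, is_flow m g e X l0 y.
Proof.
intros Hg Hm Hb He HX.
destruct (flowH_lipschitz m g b e Hg Hm Hb He) as [L [HL HK]].
apply (picard_existence (flowH m g e X) (slopeK g b) L e l0 HL).
- intros t y; destruct (flowH_bounds m g b e X t y Hg Hm Hb He HX).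
  rewrite Rabs_pos_eq; lra.
- intros t t' y y'; apply Rle_trans with (1 := HK X X t t' y y' HX HX).
  rewrite Rminus_diag, Rabs_R0; apply Rmult_le_compat_l; lra.
Qed.

Lemma flow_growth m g b e X l0 y t t' : 1 < g <= 3 -> 1 <= m <= 2 -> b < 1 -> 0 < e <= 1 ->
  xL g <= X <= b -> is_flow m g e X l0 y -> e <= t <= t' ->
  0 <= y t' - y t <= slopeK g b * (t' - t).
Proof.
intros Hg Hm Hb He HX [_ Hy] Ht; split.
- enough (y t <= y t') by lra.
  apply derive_nonneg_le with (fun s => flowH m g e X s (y s)); [lra| |].
  + intros; apply Hy; lra.
  + intros; now apply flowH_bounds with b.
- enough (slopeK g b * t - y t <= slopeK g b * t' - y t') by lra.
  apply (derive_nonneg_le (fun s => slopeK g b * s - y s)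
     (fun s => slopeK g b - flowH m g e X s (y s))); [lra| |].
  + intros s Hs.
    apply (is_derive_minus (V := R_NormedModule) (fun s => slopeK g b * s) y).
    * auto_derive; [trivial|ring].
    * apply Hy; lra.
  + intros s Hs; destruct (flowH_bounds m g b e X s (y s) Hg Hm Hb He HX); lra.
Qed.

(** The end time X - x_1 moves with X. Gronwall compares two flows at the end time of one of them,
    and the growth bound accounts for the shift of the end time. *)
Theorem flow_end_continuous m g a b e (l0 : R -> R) (y : R -> R -> R) :
  1 < g <= 3 -> 1 <= m <= 2 -> b < 1 -> 0 < e -> xL g + e <= a ->
  continuous_within a b l0 ->
  (forall X, a <= X <= b -> is_flow m g e X (l0 X) (y X)) ->
  continuous_within a b (fun X => y X (X - xL g)).
Proof.
intros Hg Hm Hb He Ha Hl0 Hy.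
intros X HX eps Heps.
assert (Pl := xL_pos g (proj1 Hg)).
assert (He1 : 0 < e <= 1) by lra.
destruct (flowH_lipschitz m g b e Hg Hm Hb He1) as [L [HL HK]].
assert (HKp : 0 <= slopeK g b).
{ destruct (flowH_bounds m g b e X 0 0 Hg Hm Hb He1 ltac:(lra)); lra. }
set (M := exp (2 * L + 1)).
assert (HM : 0 < M) by apply exp_pos.
(* Initial difference and forcing are each kept below eta / 2, so the squares sum to less than
   eta^2, and Gronwall leaves at most eta sqrt M < eps / 2. The factor M covers all times because
   they do not exceed 1. *)
set (eta := eps / 2 / (sqrt M + 1)).
assert (HsM : 0 <= sqrt M) by apply sqrt_pos.
assert (Heta : 0 < eta) by (unfold eta; repeat apply Rdiv_lt_0_compat; lra).
destruct (Hl0 X HX (eta / 2) ltac:(lra)) as [d1 [Hd1 Hl]].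
exists (Rmin d1 (Rmin (eta / 2 / L) (eps / 2 / (slopeK g b + 1)))); split.
{ repeat apply Rmin_glb_lt; [exact Hd1| |]; repeat apply Rdiv_lt_0_compat; lra. }
intros Y HY HYX.
assert (D1 : Rabs (Y - X) < d1) by (apply Rlt_le_trans with (1 := HYX), Rmin_l).
assert (D2 : Rabs (Y - X) < eta / 2 / L).
{ apply Rlt_le_trans with (1 := HYX), Rle_trans with (1 := Rmin_r _ _), Rmin_l. }
assert (D3 : Rabs (Y - X) < eps / 2 / (slopeK g b + 1)).
{ apply Rlt_le_trans with (1 := HYX), Rle_trans with (1 := Rmin_r _ _), Rmin_r. }
specialize (Hl Y HY D1).
set (ey := L * Rabs (Y - X)).
assert (Hey : 0 <= ey < eta / 2).
{ split; [apply Rmult_le_pos; [lra|apply Rabs_pos]|].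
  unfold ey; replace (eta / 2) with (L * (eta / 2 / L)) by (field; lra).
  apply Rmult_lt_compat_l; lra. }
destruct (Hy X HX) as [IX DX]; destruct (Hy Y HY) as [IY DY].
assert (G := gronwall (y Y) (y X) (fun t => flowH m g e Y t (y Y t))
  (fun t => flowH m g e X t (y X t)) L ey e (X - xL g) ltac:(lra) ltac:(lra)
  ltac:(intros; apply DY; lra) ltac:(intros; apply DX; lra)).
lapply G; clear G.
2:{ intros t Ht; apply Rle_trans with (1 := HK Y X t t (y Y t) (y X t) ltac:(lra) ltac:(lra)).
  rewrite Rminus_diag, Rabs_R0; unfold ey; right; ring. }
intros G; rewrite IX, IY in G.
assert (G2 : Rabs (y Y (X - xL g) - y X (X - xL g)) < eps / 2).
{   assert (E1 : exp ((2 * L + 1) * (X - xL g - e)) <= M).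
  { unfold M; destruct (Req_dec (X - xL g - e) 1) as [->|]; [rewrite Rmult_1_r; lra|].
    left; apply exp_increasing; nra. }
  set (A1 := l0 Y - l0 X) in *.
  assert (E2 : A1 ^ 2 + ey ^ 2 < eta ^ 2).
  { apply Rabs_def2 in Hl; nra. }
  assert (E3 : (y Y (X - xL g) - y X (X - xL g)) ^ 2 <= eta ^ 2 * M).
  { apply Rle_trans with (1 := G), Rmult_le_compat; try lra.
    - generalize (pow2_ge_0 A1) (pow2_ge_0 ey); lra.
    - left; apply exp_pos. }
  assert (E4 : eta ^ 2 * M <= (eta * sqrt M) ^ 2).
  { rewrite Rpow_mult_distr; simpl (sqrt M ^ 2); rewrite Rmult_1_r, sqrt_sqrt; lra. }
  assert (E5 : eta * sqrt M < eps / 2).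
  { replace (eps / 2) with (eta * (sqrt M + 1)) by (unfold eta; field; lra).
    apply Rmult_lt_compat_l; lra. }
  assert (E6 : 0 <= eta * sqrt M) by (apply Rmult_le_pos; lra).
  assert (E7 : Rabs (y Y (X - xL g) - y X (X - xL g)) <= eta * sqrt M).
  { rewrite <- (Rabs_pos_eq (eta * sqrt M)) by exact E6.
    apply Rsqr_le_abs_0; unfold Rsqr; nra. }
  apply Rle_lt_trans with (1 := E7), E5. }
assert (G3 : Rabs (y Y (Y - xL g) - y Y (X - xL g)) < eps / 2).
{ apply Rle_lt_trans with (slopeK g b * Rabs (Y - X)).
  - destruct (Rle_or_lt X Y) as [H|H].
    + destruct (flow_growth m g b e Y _ (y Y) (X - xL g) (Y - xL g) Hg Hm Hb He1
        ltac:(lra) (Hy Y HY) ltac:(lra)).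
      rewrite !Rabs_pos_eq; lra.
    + destruct (flow_growth m g b e Y _ (y Y) (Y - xL g) (X - xL g) Hg Hm Hb He1
        ltac:(lra) (Hy Y HY) ltac:(lra)).
      rewrite !Rabs_left1; lra.
  - apply Rle_lt_trans with ((slopeK g b + 1) * Rabs (Y - X)).
    + generalize (Rabs_pos (Y - X)); nra.
    + replace (eps / 2) with ((slopeK g b + 1) * (eps / 2 / (slopeK g b + 1)))
        by (field; lra).
      apply Rmult_lt_compat_l; lra. }
apply Rabs_def2 in G2; apply Rabs_def2 in G3; apply Rabs_def1; lra.
Qed.

(** * Translation back to P_6, P_8 and their slope equation *)

Lemma slope_root_spec m g X p : 1 < g <= 3 -> 1 <= m <= 2 -> xL g <= X < 1 ->
  Vs p g (zX g X) = X - 1 -> slope_root m g (zX g X) p (slope m g X).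
Proof.
intros Hg Hm HX HV.
assert (HC : Cs p g (zX g X) = X).
{ destruct p; simpl in *; unfold C6, C8; lra. }
destruct (slope_spec m g X Hg Hm HX) as [_ [_ [_ [Hc [HQ _]]]]].
assert (Pl := xL_pos g (proj1 Hg)).
assert (Hden := zX_den g X (proj1 Hg) ltac:(lra)).
unfold slope_root; rewrite HV, HC.
assert (DGV : Derive (fun v => Gf m g (zX g X) v X) (X - 1) = qG m g X X).
{ apply is_derive_unique; unfold Gf, lam; auto_derive; [trivial|].
  unfold qG, zX; field; lra. }
assert (DGC : Derive (fun c => Gf m g (zX g X) (X - 1) c) X = - slopeA m g X).
{ apply is_derive_unique; unfold Gf, lam; auto_derive; [trivial|].
  unfold slopeA, dG, zX; field; lra. }
assert (DFV : Derive (fun v => Ff m g (zX g X) v X) (X - 1) = - rF m g X X).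
{ apply is_derive_unique; unfold Ff; auto_derive; [apply Rgt_not_eq; lra|].
  unfold rF, a1, a2, zX; field; repeat split; apply Rgt_not_eq; lra. }
assert (DFC : Derive (fun c => Ff m g (zX g X) (X - 1) c) X = 2 * X * (X + m * zX g X)).
{ apply is_derive_unique; unfold Ff; auto_derive; [trivial|].
  unfold a1, a2, a3, zX; field; repeat split; apply Rgt_not_eq; lra. }
rewrite DGV, DGC, DFV, DFC; split; [exact Hc|].
rewrite <- HQ; unfold slopeB; ring.
Qed.

Lemma sonic_point g X : 1 < g <= 3 -> xL g < X < 1 ->
  exists p, Zset p g (zX g X) /\ Vs p g (zX g X) = X - 1.
Proof.
intros Hg HX.
assert (Pl := xL_pos g (proj1 Hg)); assert (El := xL_eq g (proj1 Hg)).
assert (HX1 : 0 < X < 1) by lra.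
assert (Ez := zX_eq g X (proj1 Hg) HX1); assert (Pz := zX_pos g X (proj1 Hg) HX1).
set (z := zX g X) in *.
assert (HzM : z <= zM g).
{ unfold zM.
  assert (Hs := sqrt_sqrt g ltac:(lra)); assert (Hk := sqrt_sqrt 2 ltac:(lra)).
  assert (0 < sqrt g) by (apply sqrt_lt_R0; lra).
  assert (0 < sqrt 2) by (apply sqrt_lt_R0; lra).
  set (s := sqrt g) in *; set (k := sqrt 2) in *.
  assert (Hsk : 0 < (s + k) ^ 2) by nra.
  apply Rmult_le_reg_r with ((s + k) ^ 2); [exact Hsk|].
  rewrite Rinv_l by lra.
  (* The difference of the two sides is the square of sqrt g (1 - X) - sqrt 2 X. *)
  assert (Hle : X * (1 - X) * (s + k) ^ 2 <= g * (1 - X) + 2 * X).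
  { rewrite <- Hs, <- Hk; generalize (pow2_ge_0 (s * (1 - X) - k * X)); nra. }
  assert (Hd := zX_den g X (proj1 Hg) HX1).
  apply Rmult_le_reg_l with (g * (1 - X) + 2 * X); [lra|].
  rewrite Rmult_1_r; apply Rle_trans with (2 := Hle); rewrite <- Ez; right; ring. }
set (v := X - 1) in *.
assert (Hv : v * v + (1 + (2 - g) * z) * v + 2 * z = 0) by (unfold v; nra).
assert (Hdisc : 1 - 2 * (g + 2) * z + (g - 2) ^ 2 * z ^ 2 = (2 * v + 1 - (g - 2) * z) ^ 2)
  by nra.
unfold Vs, V6, V8, Zset, wfun; rewrite Hdisc.
(* This quantity is w on the branch of P_8 and - w on that of P_6, so its sign selects the
   branch. *)
destruct (Rle_or_lt 0 (2 * v + 1 - (g - 2) * z)) as [H|H].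
- exists P8; split; [lra|]; rewrite sqrt_pow2 by exact H; field.
- exists P6.
  replace ((2 * v + 1 - (g - 2) * z) ^ 2) with ((- (2 * v + 1 - (g - 2) * z)) ^ 2) by ring.
  rewrite sqrt_pow2 by lra; split; [split; [|exact HzM]|field].
  unfold zm.
  assert (Hden : 0 < (2 * g - 1) * (g + 1)) by nra.
  apply Rmult_le_reg_r with ((2 * g - 1) * (g + 1)); [exact Hden|].
  unfold Rdiv; rewrite Rmult_assoc, Rinv_l, Rmult_1_r by lra.
  (* both roots lie to the right of [V1], where the quadratic is therefore positive *)
  set (u := xL g - 1).
  assert (Hu : 0 < u * u + (1 + (2 - g) * z) * u + 2 * z).
  { replace (u * u + (1 + (2 - g) * z) * u + 2 * z) with
      ((u - v) * (u + v + 1 + (2 - g) * z) + (v * v + (1 + (2 - g) * z) * v + 2 * z)) by ring.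
    rewrite Hv, Rplus_0_r.
    replace ((u - v) * (u + v + 1 + (2 - g) * z)) with
      ((v - u) * - (u + v + 1 + (2 - g) * z)) by ring.
    unfold u, v in *; apply Rmult_lt_0_compat; lra. }
  assert (Hu2 : u * (g + 1) = -2) by (unfold u; lra).
  assert (Hpos : 0 < (u * u + (1 + (2 - g) * z) * u + 2 * z) * ((g + 1) * (g + 1)))
    by (apply Rmult_lt_0_compat; [exact Hu|nra]).
  replace ((u * u + (1 + (2 - g) * z) * u + 2 * z) * ((g + 1) * (g + 1))) with
    ((u * (g + 1)) * (u * (g + 1)) + (1 + (2 - g) * z) * (u * (g + 1)) * (g + 1)
     + 2 * z * ((g + 1) * (g + 1))) in Hpos by ring.
  rewrite Hu2 in Hpos; lra.
Qed.

Lemma V1pt_xL g : 1 < g -> V1pt g = xL g - 1.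
Proof. intros Hg; unfold V1pt, xL; field; lra. Qed.

(** After squaring: (g - 1)^2 < 2 g (g - 1) < (g + 1)^2, the second inequality being g^2 < 4 g + 1.
    Thus X = C_1 is an admissible sonic point. *)
Lemma C1pt_bounds g : 1 < g <= 3 -> xL g < C1pt g < 1.
Proof.
intros Hg; unfold xL, C1pt.
assert (Hi : 0 < / (g + 1)) by (apply Rinv_0_lt_compat; lra).
split.
- apply Rmult_lt_compat_r; [exact Hi|].
  rewrite <- (sqrt_pow2 (g - 1)) at 1 by lra; apply sqrt_lt_1_alt; nra.
- apply Rmult_lt_reg_r with (g + 1); [lra|].
  unfold Rdiv; rewrite Rmult_assoc, Rinv_l, Rmult_1_r, Rmult_1_l by lra.
  rewrite <- (sqrt_pow2 (g + 1)) by lra; apply sqrt_lt_1_alt; nra.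
Qed.

(** * From the local solution and the flow to a solution on [V_1, V_*] *)

Lemma is_derive_glue (f1 f2 : R -> R) x l : f1 x = f2 x ->
  is_derive f1 x l -> is_derive f2 x l ->
  is_derive (fun u => if Rle_dec x u then f1 u else f2 u) x l.
Proof.
intros E H1 H2; apply is_derive_Reals in H1; apply is_derive_Reals in H2.
apply is_derive_Reals; intros eps Heps.
destruct (H1 eps Heps) as [d1 K1]; destruct (H2 eps Heps) as [d2 K2].
assert (Hd : 0 < Rmin d1 d2) by (apply Rmin_glb_lt; apply cond_pos).
exists (mkposreal _ Hd); intros h Hh Hlt; simpl in Hlt.
destruct (Rle_dec x x) as [_|Hn]; [|exfalso; apply Hn; lra].
destruct (Rle_dec x (x + h)).
- apply K1; [exact Hh|]; apply Rlt_le_trans with (1 := Hlt), Rmin_l.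
- rewrite E; apply K2; [exact Hh|]; apply Rlt_le_trans with (1 := Hlt), Rmin_r.
Qed.

Lemma G_neg m g X V C : 1 < g -> 1 <= m <= 2 -> 0 < X < 1 -> 0 <= 1 + V < X -> X <= C ->
  Gf m g (zX g X) V C < 0.
Proof.
intros Hg Hm HX HV HC.
rewrite (Gf_factor m g X V C Hg HX).
assert (Hq := qG_lower m g X (1 + V) Hg HX Hm ltac:(lra)).
assert (Hd := dG_lower m g X (1 + V) Hg HX (proj1 Hm) ltac:(lra)).
assert (0 < X * (1 - X)) by nra.
assert (0 < (X - (1 + V)) * qG m g X (1 + V)) by (apply Rmult_lt_0_compat; lra).
assert (0 <= (C ^ 2 - X ^ 2) * dG m g X (1 + V)) by (apply Rmult_le_pos; nra).
lra.
Qed.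

(** Multiplied by p, G becomes - [denR] and x F becomes C times [numR]; p cancels in F / G. The
    minus sign reflects that t = X - x runs to the left. *)
Lemma flow_ode m g X b e t l : 1 < g <= 3 -> 1 <= m <= 2 -> b < 1 -> 0 < e <= 1 ->
  xL g <= X <= b -> e <= t <= X - xL g -> 0 <= l ->
  Ff m g (zX g X) (X - t - 1) (X * exp l) / Gf m g (zX g X) (X - t - 1) (X * exp l)
  = - (X * exp l * flowH m g e X t l).
Proof.
intros Hg Hm Hb He HX Ht Hl.
assert (Pl := xL_pos g (proj1 Hg)); assert (HX1 : 0 < X < 1) by lra.
assert (Hel := exp_pos l).
assert (Hxn : 1 + (X - t - 1) <> 0) by (apply Rgt_not_eq; lra).
assert (HF := Ff_factor m g X (X - t - 1) (X * exp l) (proj1 Hg) HX1 Hxn).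
assert (HG := Gf_factor m g X (X - t - 1) (X * exp l) (proj1 Hg) HX1).
replace (1 + (X - t - 1)) with (X - t) in * by ring.
unfold flowH, hR; rewrite tclamp_id by lra.
assert (Hx : xclamp g X t = X - t) by (unfold xclamp; apply Rmax_left; lra).
destruct (hR_bounds m g b X t (pl l) Hg Hm Hb HX ltac:(lra) (pl_bounds l)) as [Hden _].
assert (Hpl : pl l * (exp l * exp l) = 1).
{ unfold pl; rewrite Rmax_left by lra.
  rewrite <- !exp_plus, <- exp_0; f_equal; ring. }
assert (Hplp : 0 < pl l) by apply exp_pos.
unfold numR, denR in *; rewrite Hx in *.
set (F := Ff m g (zX g X) (X - t - 1) (X * exp l)) in *.
set (G := Gf m g (zX g X) (X - t - 1) (X * exp l)) in *.
set (q := qG m g X (X - t)) in *; set (d := dG m g X (X - t)) in *.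
set (r := rF m g X (X - t)) in *; set (z := zX g X) in *.
set (p := pl l) in *; set (E := exp l) in *.
set (N := t * p * r + X * X * (1 - p) * (X - t + m * z)) in *.
set (D := t * p * q + X * X * (1 - p) * d) in *.
assert (HpG : p * G = - D).
{ rewrite HG; unfold D.
  transitivity (- (t * p * q + X * X * (p * (E * E) - p) * d)); [ring|rewrite Hpl; ring]. }
assert (HpF : p * ((X - t) * F) = X * E * N).
{ rewrite HF; unfold N.
  transitivity (X * E * (t * p * r + X * X * (p * (E * E) - p) * (X - t + m * z)));
    [ring|rewrite Hpl; ring]. }
assert (HGn : G <> 0) by nra.
assert (HFe : F = X * E * N / (p * (X - t))) by (rewrite <- HpF; field; split; lra).
assert (HGe : G = - D / p) by (rewrite <- HpG; field; lra).
rewrite HFe, HGe; field; repeat split; lra.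
Qed.

Definition clampI (a b X : R) : R := Rmax (Rmin X b) a.

Lemma clampI_in a b X : a <= b -> a <= clampI a b X <= b.
Proof. intros H; unfold clampI, Rmax, Rmin; repeat destruct Rle_dec; lra. Qed.

Lemma clampI_id a b X : a <= X <= b -> clampI a b X = X.
Proof. intros H; unfold clampI, Rmax, Rmin; repeat destruct Rle_dec; lra. Qed.

Lemma clampI_lipschitz a b X Y : Rabs (clampI a b X - clampI a b Y) <= Rabs (X - Y).
Proof.
apply Rle_trans with (1 := Rmax_lipschitz a _ _).
unfold Rmin; repeat destruct Rle_dec; unfold Rabs; repeat destruct Rcase_abs; lra.
Qed.

Lemma continuous_within_clampI a b f : a <= b -> continuous_within a b f ->
  forall X, continuous (fun Y => f (clampI a b Y)) X.
Proof.
intros Hab Hf X; apply filterlim_locally; intros eps.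
destruct (Hf (clampI a b X) (clampI_in a b X Hab) eps (cond_pos eps)) as [d [Hd K]].
exists (mkposreal d Hd); intros Y HY; apply K; [now apply clampI_in|].
apply Rle_lt_trans with (1 := clampI_lipschitz a b Y X), HY.
Qed.

Lemma clampI_continuous_within a b f :
  (forall X, continuous (fun Y => f (clampI a b Y)) X) -> continuous_within a b f.
Proof.
intros Hf X HX eps Heps.
destruct (proj1 (filterlim_locally _ _) (Hf X) (mkposreal eps Heps)) as [d Hd].
exists d; split; [apply cond_pos|]; intros Y HY HYX.
specialize (Hd Y HYX); rewrite !clampI_id in Hd by assumption; exact Hd.
Qed.

(** The slope stays away from 0 because its reciprocal is continuous, hence bounded, on the compact
    interval. Adding 1 makes both constants positive. *)
Lemma slope_uniform m g b : 1 < g <= 3 -> 1 <= m <= 2 -> b < 1 ->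
  exists k K, 0 < k /\ 0 < K /\
    forall X, xL g <= X <= b -> - K <= slope m g X <= - k.
Proof.
intros Hg Hm Hb.
assert (Hc : forall X, xL g <= X <= b -> continuous (fun Y => slope m g Y) X).
{ intros X HX; apply continuous_slope; lra. }
assert (Hs : forall X, xL g <= X <= b -> slope m g X < 0).
{ intros X HX; destruct (slope_spec m g X Hg Hm ltac:(lra)) as [_ [_ [_ [H _]]]]; exact H. }
destruct (continuous_bounded_on _ _ _ Hc) as [K [HK K1]].
destruct (continuous_bounded_on (fun X => / slope m g X) (xL g) b) as [K' [HK' K2]].
{ intros X HX; apply continuous_Rinv_comp; [now apply Hc|].
  apply Rlt_not_eq; now apply Hs. }
exists (/ (K' + 1)), (K + 1); split; [apply Rinv_0_lt_compat; lra|split; [lra|]].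
intros X HX; specialize (K1 X HX); specialize (K2 X HX); specialize (Hs X HX).
rewrite Rabs_left in K1 by exact Hs.
rewrite Rabs_inv, Rabs_left in K2 by exact Hs.
split; [lra|].
assert (Hi : / (K' + 1) <= / / (- slope m g X)).
{ apply Rinv_le_contravar; [apply Rinv_0_lt_compat|]; lra. }
rewrite Rinv_inv in Hi; lra.
Qed.

Lemma is_derive_loc m g X w r A t : (forall N, wnorm r w N <= A) -> Rabs t < r ->
  is_derive (loc_y m g X w) t (loc_dy m g X w t).
Proof.
intros HA Ht.
assert (D := is_derive_PSeries w t (CV_radius_wnorm_lt r w A t HA Ht)).
unfold loc_y, loc_dy.
assert (Xd : ex_derive (PSeries w) t) by (eexists; exact D).
auto_derive; [exact Xd|].
assert (E : Derive (fun x : R => PSeries w x) t = PSeries (PS_derive w) t)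
  by exact (is_derive_unique _ _ _ D).
rewrite E; ring.
Qed.

Lemma loc_pseries m g X w r A t : w 0%nat = 0 -> (forall N, wnorm r w N <= A) ->
  Rabs t < r ->
  is_pseries (fun n => match n with
      | 0%nat => X
      | S k => match k with 0%nat => slope m g X | S _ => w k end
    end) t (loc_y m g X w t).
Proof.
intros H0 HA Ht; apply is_pseries_head.
assert (Hw := PSeries_correct w t
  (CV_radius_inside _ _ (CV_radius_wnorm_lt r w A t HA Ht))).
assert (Hc := is_pseries_head (slope m g X) _ t 0 (is_pseries_zero t)).
rewrite Rmult_0_r, Rplus_0_r in Hc.
apply is_pseries_ext with (2 := is_pseries_plus _ _ _ _ _ Hc Hw).
intros [|n]; unfold PS_plus, plus; simpl; [rewrite H0|]; ring.
Qed.

(** The condition 2 e <= X - x_1 puts the junction V_* - e to the right of V_1 and keeps 1 + V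
    positive on the disc of radius e about V_*. *)
Lemma glued_solution m g b X e r A w y p :
  1 < g <= 3 -> 1 <= m <= 2 -> b < 1 -> xL g < X <= b ->
  0 < e < r -> r <= 1 -> 2 * e <= X - xL g ->
  Vs p g (zX g X) = X - 1 ->
  w 0%nat = 0 -> (forall N, wnorm r w N <= A) ->
  slope m g X + A <= 0 ->
  (forall t, Rabs t < r -> 0 < X + t ->
     Gf m g (zX g X) (X + t - 1) (loc_y m g X w t) * loc_dy m g X w t
     = Ff m g (zX g X) (X + t - 1) (loc_y m g X w t)) ->
  is_flow m g e X (ln (loc_y m g X w (- e) / X)) y ->
  exists C, is_Pstar_solution m g (zX g X) p C /\
    C (V1pt g) = X * exp (y (X - xL g)).
Proof.
intros Hg Hm Hb HX He Hr1 He2 HV Hw0 HA HsA Hode Hy.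
assert (Pl := xL_pos g (proj1 Hg)); assert (HX1 : 0 < X < 1) by lra.
assert (HC0 : Cs p g (zX g X) = X) by (destruct p; simpl in *; unfold C6, C8; lra).
assert (Hr0 : 0 < r) by lra.
assert (He1 : 0 < e <= 1) by lra.
assert (HXb : xL g <= X <= b) by lra.
(* Here |w| <= A and c + A <= 0 give c + w <= 0, so t (c + w) >= 0 to the left of the sonic
   point. *)
assert (Hloc : forall t, - r < t <= 0 -> X <= loc_y m g X w t).
{ intros t Ht.
  assert (Htr : Rabs t < r) by (rewrite Rabs_left1; lra).
  assert (Hb1 := PSeries_bound w t r A Hr0 Htr HA Hw0).
  assert (PSeries w t <= A) by (apply Rle_trans with (2 := Hb1), Rle_abs).
  unfold loc_y; nra. }
assert (Hle : X <= loc_y m g X w (- e)) by (apply Hloc; lra).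
assert (Hl0 : 0 <= ln (loc_y m g X w (- e) / X)).
{ rewrite <- ln_1; apply Rcomplements.ln_le; [lra|].
  apply Rmult_le_reg_r with X; [lra|]; unfold Rdiv; rewrite Rmult_assoc, Rinv_l; lra. }
assert (Hy0 : forall t, e <= t -> 0 <= y t).
{ intros t Ht.
  destruct (flow_growth m g b e X _ y e t Hg Hm Hb He1 HXb Hy ltac:(lra)) as [H _].
  rewrite (proj1 Hy) in H; lra. }
set (V0 := X - 1).
set (f1 := fun V => loc_y m g X w (V - V0)).
set (f2 := fun V => X * exp (y (V0 - V))).
set (C := fun V => if Rle_dec (V0 - e) V then f1 V else f2 V).
assert (Df1 : forall V, Rabs (V - V0) < r ->
   is_derive f1 V (loc_dy m g X w (V - V0))).
{ intros V HVr; unfold f1.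
  assert (D := is_derive_comp (loc_y m g X w) (fun V => V - V0) V _ 1
    (is_derive_loc m g X w r A (V - V0) HA HVr)).
  unfold scal in D; simpl in D; unfold mult in D; simpl in D; rewrite Rmult_1_l in D.
  apply D; auto_derive; [trivial|ring]. }
assert (Df2 : forall V, V <= V0 - e -> is_derive f2 V
   (- (X * exp (y (V0 - V)) * flowH m g e X (V0 - V) (y (V0 - V))))).
{ intros V HVe; unfold f2.
  assert (D := proj2 Hy (V0 - V) ltac:(lra)).
  assert (Xd : ex_derive y (V0 - V)) by (eexists; exact D).
  auto_derive; [exact Xd|].
  assert (E : Derive (fun x : R => y x) (V0 - V) = flowH m g e X (V0 - V) (y (V0 - V)))
    by exact (is_derive_unique _ _ _ D).
  replace (V0 + - V) with (V0 - V) by ring.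
  rewrite E; ring. }
assert (Ef : f1 (V0 - e) = f2 (V0 - e)).
{ unfold f1, f2; replace (V0 - e - V0) with (- e) by ring.
  replace (V0 - (V0 - e)) with e by ring.
  rewrite (proj1 Hy), exp_ln; [field; lra|].
  apply Rdiv_lt_0_compat; lra. }
assert (Of1 : forall V, V0 - r < V < V0 -> xL g < 1 + V ->
   loc_dy m g X w (V - V0) = Ff m g (zX g X) V (f1 V) / Gf m g (zX g X) V (f1 V)).
{ intros V HVr HxV.
  assert (HG : Gf m g (zX g X) V (f1 V) < 0).
  { apply G_neg; auto; try lra; [unfold V0 in *; lra|]. apply Hloc; lra. }
  assert (O := Hode (V - V0) ltac:(rewrite Rabs_left; lra) ltac:(unfold V0; lra)).
  replace (X + (V - V0) - 1) with V in O by (unfold V0; ring).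
  fold (f1 V) in O; rewrite <- O; field; lra. }
assert (Of2 : forall V, V <= V0 - e -> xL g <= 1 + V ->
   - (X * exp (y (V0 - V)) * flowH m g e X (V0 - V) (y (V0 - V)))
   = Ff m g (zX g X) V (f2 V) / Gf m g (zX g X) V (f2 V)).
{ intros V HVe HxV; unfold f2.
  assert (O := flow_ode m g X b e (V0 - V) (y (V0 - V)) Hg Hm Hb He1 HXb
    ltac:(unfold V0 in *; lra) ltac:(apply Hy0; lra)).
  replace (X - (V0 - V) - 1) with V in O by (unfold V0; ring).
  now rewrite O. }
assert (HCX : forall V, xL g <= 1 + V -> V <= V0 -> X <= C V).
{ intros V HxV HVV; unfold C; destruct (Rle_dec (V0 - e) V).
  - apply Hloc; lra.
  - unfold f2; assert (H := Hy0 (V0 - V) ltac:(lra)).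
    assert (H1 := exp_ineq1_le (y (V0 - V))); nra. }
exists C; split.
2:{ unfold C; rewrite (V1pt_xL g (proj1 Hg)).
  destruct (Rle_dec (V0 - e) (xL g - 1)); [unfold V0 in *; lra|].
  unfold f2, V0; do 2 f_equal; f_equal; ring. }
unfold is_Pstar_solution; rewrite HV, HC0, (V1pt_xL g (proj1 Hg)); fold V0.
split; [unfold V0; lra|]; split; [|split; [|split]].
- exists f1.
  eexists; exists e; split; [lra|]; split; [|split; [|split; [|split]]].
  + intros x Hx; unfold f1; apply (loc_pseries m g X w r A); auto; lra.
  + intros x Hx; assert (D := Df1 x ltac:(lra)); split; [eexists; exact D|].
    rewrite (is_derive_unique _ _ _ D).
    assert (O := Hode (x - V0) ltac:(lra)).
    replace (X + (x - V0) - 1) with x in O by (unfold V0; ring).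
    apply O; apply Rabs_def2 in Hx; unfold V0 in *; lra.
  + unfold f1; rewrite Rminus_diag; unfold loc_y; rewrite Rmult_0_l; ring.
  + assert (D := Df1 V0 ltac:(rewrite Rminus_diag, Rabs_R0; lra)).
    rewrite (is_derive_unique _ _ _ D), Rminus_diag; unfold loc_dy.
    rewrite PSeries_0, Hw0, Rmult_0_l, !Rplus_0_r.
    apply slope_root_spec; auto; lra.
  + intros x Hx Hxe; unfold C; destruct (Rle_dec (V0 - e) x); [reflexivity|].
    apply Rabs_def2 in Hxe; lra.
- intros V HVV; split.
  { apply Rlt_not_eq, G_neg; auto; try lra; [unfold V0 in *; lra|apply HCX; lra]. }
  destruct (Rtotal_order V (V0 - e)) as [Hlt|[Heq|Hgt]].
  + assert (EC : C V = f2 V) by (unfold C; destruct (Rle_dec (V0 - e) V); [lra|reflexivity]).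
    rewrite EC, <- Of2 by lra.
    apply is_derive_ext_loc with (2 := Df2 V ltac:(lra)).
    assert (Hd : 0 < V0 - e - V) by lra.
    exists (mkposreal _ Hd); intros u Hu; apply Rabs_def2 in Hu; simpl in Hu.
    unfold C; destruct (Rle_dec (V0 - e) u); [|reflexivity].
    unfold minus, plus, opp in Hu; simpl in Hu; lra.
  + assert (EC : C V = f2 V).
    { unfold C; destruct (Rle_dec (V0 - e) V); [rewrite Heq; exact Ef|reflexivity]. }
    assert (D2 := Df2 V ltac:(lra)); rewrite Of2 in D2 by lra.
    rewrite EC.
    assert (D1 := Df1 V ltac:(rewrite Rabs_left; lra)).
    rewrite Of1 in D1 by lra.
    assert (Ef' : f1 V = f2 V) by (rewrite Heq; exact Ef).
    rewrite Ef' in D1.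
    (* Both pieces have derivative F / G at the same point, so the two-sided derivative required at
       the junction exists. *)
    assert (G := is_derive_glue f1 f2 V _ Ef' D1 D2).
    apply is_derive_ext with (2 := G); intros u; unfold C; rewrite Heq; reflexivity.
  + assert (EC : C V = f1 V) by (unfold C; destruct (Rle_dec (V0 - e) V); [reflexivity|lra]).
    rewrite EC, <- Of1 by lra.
    apply is_derive_ext_loc with (2 := Df1 V ltac:(rewrite Rabs_left; lra)).
    assert (Hd : 0 < V - (V0 - e)) by lra.
    exists (mkposreal _ Hd); intros u Hu; apply Rabs_def2 in Hu; simpl in Hu.
    unfold minus, plus, opp in Hu; simpl in Hu.
    unfold C; destruct (Rle_dec (V0 - e) u); [reflexivity|lra].
- assert (HV1 : xL g - 1 < V0 - e) by (unfold V0; lra).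
  assert (EC : f2 (xL g - 1) = C (xL g - 1))
    by (unfold C; destruct (Rle_dec (V0 - e) (xL g - 1)); [lra|reflexivity]).
  assert (Hcont : continuous C (xL g - 1)).
  { apply continuous_ext_loc with f2.
    - assert (Hd : 0 < V0 - e - (xL g - 1)) by lra.
      exists (mkposreal _ Hd); intros u Hu; apply Rabs_def2 in Hu; simpl in Hu.
      unfold minus, plus, opp in Hu; simpl in Hu.
      unfold C; destruct (Rle_dec (V0 - e) u); [lra|reflexivity].
    - apply (ex_derive_continuous (V := R_NormedModule)).
      eexists; apply Df2; lra. }
  apply filterlim_filter_le_1 with (2 := Hcont); apply filter_le_within.
- intros V HVV; apply Rlt_le_trans with X; [lra|]; apply HCX; lra.
Qed.

(** * Shooting in X *)

Lemma left_endpoint xl b K : 0 < xl < b ->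
  exists a, xl < a < b /\ a * exp (K * (a - xl)) <= b.
Proof.
intros Hb.
assert (Hc : continuous (fun x => x * exp (K * (x - xl))) xl).
{ apply (ex_derive_continuous (V := R_NormedModule)); auto_derive; trivial. }
assert (Hd : 0 < b - xl) by lra.
destruct (proj1 (filterlim_locally _ _) Hc (mkposreal _ Hd)) as [d H].
set (a := xl + Rmin (d / 2) ((b - xl) / 2)).
assert (M1 : Rmin (d / 2) ((b - xl) / 2) <= d / 2) by apply Rmin_l.
assert (M2 : Rmin (d / 2) ((b - xl) / 2) <= (b - xl) / 2) by apply Rmin_r.
assert (M3 : 0 < Rmin (d / 2) ((b - xl) / 2)).
{ apply Rmin_glb_lt; [generalize (cond_pos d)|]; lra. }
exists a; split; [unfold a; lra|].
assert (Ha : Rabs (a - xl) < d).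
{ rewrite Rabs_pos_eq; unfold a; generalize (cond_pos d); lra. }
specialize (H a Ha).
change (Rabs (a * exp (K * (a - xl)) - xl * exp (K * (xl - xl))) < b - xl) in H.
rewrite Rminus_diag, Rmult_0_r, exp_0 in H; apply Rabs_def2 in H; lra.
Qed.

Lemma ln_1p_le x : 0 <= x -> ln (1 + x) <= x.
Proof.
intros Hx; rewrite <- (ln_exp x) at 2; apply Rcomplements.ln_le; [lra|apply exp_ineq1_le].
Qed.

Theorem mainTheorem6 :
  forall (m : nat) (g : R),
    (m = 1%nat \/ m = 2%nat) -> 1 < g <= 3 ->
    exists (p : Pstar) (zstd : R),
      Zset p g zstd /\
      exists C : R -> R,
        is_Pstar_solution (INR m) g zstd p C /\ C (V1pt g) = C1pt g.
Proof.
intros n g Hn Hg.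
set (m := INR n).
assert (Hm : 1 <= m <= 2) by (unfold m; destruct Hn as [-> | ->]; simpl; lra).
clearbody m; clear n Hn.
(* C_1 is both the right end of the X-interval and the value to be attained. *)
set (b := C1pt g).
assert (Hb : xL g < b < 1) by now apply C1pt_bounds.
assert (Pl := xL_pos g (proj1 Hg)).
destruct (slope_uniform m g b Hg Hm (proj2 Hb)) as [k [K [Hk [HK HkK]]]].
(* With slope at most - k and |w| <= k / 2, the sum c + w stays negative for every X. *)
destruct (local_solution_family m g (xL g) b (k / 2) Hg Hm) as
  [r [W [Hr [HC [HW0 [HN HE]]]]]]; try lra.
assert (PK : 0 < slopeK g b).
{ unfold slopeK; assert (H := kapR_pos g b (proj1 Hg) (proj2 Hb)).
  apply Rmult_lt_0_compat; [now apply Rinv_0_lt_compat|apply Rdiv_lt_0_compat; lra]. }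
(* The flow contributes at most [slopeK] per unit of time, and the datum at distance e at most e (K
   + k) / x_1 with e <= a - x_1. As [K3] does not involve e, the end point a can be chosen before
   e. *)
set (K3 := slopeK g b + (K + k) / xL g).
destruct (left_endpoint (xL g) b K3) as [a [Ha HaK]]; [lra|].
set (e := Rmin (r / 2) ((a - xL g) / 2)).
assert (He : 0 < e /\ e <= r / 2 /\ e <= (a - xL g) / 2).
{ unfold e; split; [apply Rmin_glb_lt; lra|split; [apply Rmin_l|apply Rmin_r]]. }
assert (Her : Rabs (- e) < r) by (rewrite Rabs_left; lra).
set (ye := fun X => loc_y m g X (W X) (- e)).
set (l0 := fun X => ln (ye X / X)).
assert (Hye : forall X, a <= X <= b -> X <= ye X <= X + e * (K + k)).
{ intros X HX.
  assert (Hw := PSeries_bound (W X) (- e) r (k / 2) ltac:(lra) Her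
    (HN X ltac:(lra)) (HW0 X)).
  specialize (HkK X ltac:(lra)); apply Rabs_le_between in Hw.
  unfold ye, loc_y; set (q := PSeries (W X) (- e)) in *.
  split; nra. }
assert (Hl0 : forall X, a <= X <= b -> 0 <= l0 X <= e * ((K + k) / xL g)).
{ intros X HX; specialize (Hye X HX).
  assert (HyX : 1 <= ye X / X).
  { apply Rmult_le_reg_r with X; [lra|].
    unfold Rdiv; rewrite Rmult_assoc, Rinv_l; lra. }
  split.
  - unfold l0; rewrite <- ln_1; apply Rcomplements.ln_le; lra.
  - unfold l0; replace (ye X / X) with (1 + (ye X / X - 1)) by ring.
    apply Rle_trans with (1 := ln_1p_le (ye X / X - 1) ltac:(lra)).
    apply Rle_trans with (e * (K + k) / X).
    + replace (ye X / X - 1) with ((ye X - X) / X) by (field; lra).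
      apply Rmult_le_compat_r; [left; apply Rinv_0_lt_compat|]; lra.
    + unfold Rdiv; rewrite Rmult_assoc.
      assert (/ X <= / xL g) by (apply Rinv_le_contravar; lra).
      assert (0 < e * (K + k)) by nra.
      rewrite <- !Rmult_assoc; apply Rmult_le_compat_l; lra. }
assert (Hab : a <= b) by lra.
assert (Hcl := fun X => clampI_in a b X Hab).
assert (Hid : forall X, continuous (clampI a b) X).
{ intros X; apply (lipschitz_continuous _ 1); intros u v.
  rewrite Rmult_1_l; apply clampI_lipschitz. }
assert (Hcl0 : continuous_within a b l0).
{ apply clampI_continuous_within; intros X.
  assert (Hs : continuous (fun Y => slope m g (clampI a b Y)) X).
  { apply (continuous_comp (clampI a b) (fun Y => slope m g Y)); [apply Hid|].
    specialize (Hcl X); apply continuous_slope; lra. }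
  assert (Hp : continuous (fun Y => PSeries (W (clampI a b Y)) (- e)) X).
  { apply (continuous_within_clampI a b (fun Y => PSeries (W Y) (- e)) Hab).
    apply PSeries_continuous_within with r (k / 2); try lra; intros.
    - apply HC; lra.
    - apply HN; lra. }
  unfold l0; apply (continuous_comp (fun Y => ye (clampI a b Y) / clampI a b Y) ln).
  - assert (Hi := Hid X); unfold ye, loc_y; cont.
    specialize (Hcl X); apply Rgt_not_eq; lra.
  - specialize (Hcl X); specialize (Hye _ Hcl).
    apply (ex_derive_continuous (V := R_NormedModule)).
    eexists; apply is_derive_ln; apply Rdiv_lt_0_compat; lra. }
(* One flow is chosen for each X, with a dummy value outside [a, b]; continuity in X comes
   afterwards from Gronwall. *)
destruct (functional_choice (fun X y => a <= X <= b -> is_flow m g e X (l0 X) y))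
  as [y Hy].
{ intros X; destruct (Rle_dec a X) as [H1|H1]; [destruct (Rle_dec X b) as [H2|H2]|].
  - destruct (flow_exists m g b e X (l0 X) Hg Hm) as [y Hy]; try lra.
    now exists y.
  - exists (fun _ => 0); intros; lra.
  - exists (fun _ => 0); intros; lra. }
assert (Hyc := flow_end_continuous m g a b e l0 y Hg Hm ltac:(lra) ltac:(lra)
  ltac:(lra) Hcl0 Hy).
(* The value C(V_1) as a function of X, clamped because the intermediate value theorem is applied to
   a function continuous on the whole line. *)
set (Phi := fun X => clampI a b X * exp (y (clampI a b X) (clampI a b X - xL g))).
assert (HPc : continuity Phi).
{ intros X; apply continuity_pt_filterlim; change (continuous Phi X); unfold Phi.
  apply (continuous_Rmult (clampI a b)); [apply Hid|].
  apply (continuous_comp (fun Y => y (clampI a b Y) (clampI a b Y - xL g)) exp).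
  - exact (continuous_within_clampI a b (fun Y => y Y (Y - xL g)) Hab Hyc X).
  - apply (ex_derive_continuous (V := R_NormedModule) exp); eexists.
    apply is_derive_Reals, derivable_pt_lim_exp. }
assert (Hgrow : forall X, a <= X <= b ->
   0 <= y X (X - xL g) - l0 X <= slopeK g b * (X - xL g - e)).
{ intros X HX; rewrite <- (proj1 (Hy X HX)).
  apply (flow_growth m g b e X (l0 X)); auto; lra. }
assert (HPa : Phi a <= b).
{ unfold Phi; rewrite clampI_id by lra.
  destruct (Hgrow a ltac:(lra)) as [_ G2]; destruct (Hl0 a ltac:(lra)) as [_ L2].
  apply Rle_trans with (2 := HaK), Rmult_le_compat_l; [lra|].
  assert (Hq : 0 < (K + k) / xL g) by (apply Rdiv_lt_0_compat; lra).
  assert (y a (a - xL g) <= K3 * (a - xL g)) by (unfold K3; nra).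
  destruct (Req_dec (y a (a - xL g)) (K3 * (a - xL g))) as [->|]; [lra|].
  left; apply exp_increasing; lra. }
assert (HPb : b <= Phi b).
{ unfold Phi; rewrite clampI_id by lra.
  destruct (Hgrow b ltac:(lra)) as [G1 _]; destruct (Hl0 b ltac:(lra)) as [L1 _].
  assert (H1 := exp_ineq1_le (y b (b - xL g))); nra. }
destruct (IVT_gen Phi a b b HPc) as [X [HX HPX]].
{ split; [apply Rle_trans with (1 := Rmin_l _ _), HPa
         |apply Rle_trans with (2 := Rmax_r _ _), HPb]. }
rewrite Rmin_left, Rmax_right in HX by lra.
unfold Phi in HPX; rewrite clampI_id in HPX by exact HX.
destruct (sonic_point g X Hg ltac:(lra)) as [p [Hz HV]].
destruct (glued_solution m g b X e r (k / 2) (W X) (y X) p) as [C [HCs HC1]]; auto; try lra.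
- apply HN; lra.
- specialize (HkK X ltac:(lra)); lra.
- intros t Ht Htp; apply HE; auto; lra.
- exists p, (zX g X); split; [exact Hz|]; exists C; split; [exact HCs|].
  now rewrite HC1.
Qed.
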